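(* Let $$O=(0,0,0),\quad P=(0,0,1),\quad A_0=\left(\tfrac{3}{16},0,0\right),\quad B_0=\left(\tfrac{7}{32},\tfrac{\sqrt{15}}{32},0\right),\quad T_0=\operatorname{conv}\{O,P,A_0,B_0\}\subset\mathbb R^3 .$$ There is a nested LAB branch $(T_n)_{n\ge 0}$ starting at $T_0$, of the form $T_n=\operatorname{conv}\{O,P,A_n,B_n\}$ for points $A_n,B_n$ ($n\ge 0$, with $A_0,B_0$ as given), such that for every $n\ge 0$ the edge $PA_n$ carries the unique largest internal dihedral angle of $T_n$. Moreover, for every $n\ge0$, $$\angle OPA_n\le \frac15\left(\frac45\right)^n,\qquad \frac{h_{T_n}}{r_{T_n}}\ge \frac{64}{\sqrt{15}}\left(\frac54\right)^n,$$ and $$h_{T_n}\longrightarrow 1\ (n\to\infty),\qquad \bigcap_{n\ge 0}T_n=[O,P].$$ Nevertheless, with $\gamma=\arccos\frac78$ and $G=\arccos\left(-\frac14\right)$, for every $n\ge 0$ every internal dihedral angle $\theta_e(T_n)$ (over all edges $e$ of $T_n$) and every face angle of $T_n$ satisfy $$\gamma\le \theta_e(T_n)\le G,\qquad \Gamma(T_n)\le G<\pi .$$ Finally, for every $n\ge0$, the tetrahedron $T_n$ belongs to a conforming partition of $T_0$ obtained by $n$ LAB cuts and containing exactly $n+1$ tetrahedra.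
   Context: Largest-dihedral-angle bisection (LAB): let $T=\operatorname{conv}\{X,Y,Z,W\}$ be a nondegenerate tetrahedron in $\mathbb R^3$. Select an edge $XY$ carrying a largest internal dihedral angle of $T$. The internal angle-bisector plane through $XY$ (the plane containing line $XY$ that bisects the internal dihedral angle of $T$ at $XY$) meets the opposite edge $ZW$ at an interior point $E$ and $T$ is replaced by the two tetrahedra (children) $\operatorname{conv}\{X,Y,Z,E\}$ and $\operatorname{conv}\{X,Y,E,W\}$. A nested LAB branch starting at $T_0$ is a sequence $(T_n)_{n\ge0}$ in which each $T_{n+1}$ is one of the two children produced by applying LAB to $T_n$. For a tetrahedron $T$: $h_T=\operatorname{diam}T$; $r_T$ is its inradius; $\theta_e(T)$ is the internal dihedral angle of $T$ at the edge $e$; a face angle is an interior angle of one of the four triangular faces; and $\Gamma(T)=\max\{\text{all face angles and all internal dihedral angles of }T\}$. $[O,P]$ denotes the closed segment. A partition of $T_0$ into tetrahedra is conforming if it is face-to-face: any two distinct tetrahedra of the partition intersect in the empty set or in a common vertex, a common edge, or a common face. A partition is obtained by $n$ LAB cuts if it arises from $\{T_0\}$ by $n$ successive steps, each of which replaces one tetrahedron of the current partition by its two LAB children. *)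

(* Defs.v *)
From HB Require Import structures.
From mathcomp Require Import all_boot all_order all_algebra.
From mathcomp Require Import boolp classical_sets reals topology normedtype.
From mathcomp Require Import sequences trigo.

Set Implicit Arguments.
Unset Strict Implicit.
Unset Printing Implicit Defensive.
Import Order.TTheory GRing.Theory Num.Theory.
Import numFieldNormedType.Exports.
Local Open Scope classical_set_scope.
Local Open Scope ring_scope.

Section Euclidean.
Context {R : realType}.
Implicit Types (u v d : 'rV[R]_3) (X Y Z W E Q : 'rV[R]_3) (s : seq 'rV[R]_3).

Definition vec3 (a b c : R) : 'rV[R]_3 := \row_(i < 3) [:: a; b; c]`_i.

Definition dot u v : R := \sum_(i < 3) u 0 i * v 0 i.

(* The library norm on ['rV[R]_3] is the sup norm, so the Euclidean norm is
   introduced separately. *)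
Definition enorm u : R := Num.sqrt (dot u u).

Definition angle u v : R := acos (dot u v / (enorm u * enorm v)).

Definition angle_at X Y Z : R := angle (X - Y) (Z - Y).

(* Only the weights [a i] with [i < size s] matter; [conv [::]] is empty. *)
Definition conv s : set 'rV[R]_3 :=
  [set Q | exists a : nat -> R, [/\ forall i, 0 <= a i,
     \sum_(i < size s) a i = 1 & Q = \sum_(i < size s) a i *: s`_i]].

Definition diam (S : set 'rV[R]_3) : R :=
  sup [set enorm (p.1 - p.2) | p in S `*` S].

Definition inradius (S : set 'rV[R]_3) : R :=
  sup [set r | 0 <= r /\
    exists c, [set Q | enorm (Q - c) <= r] `<=` S].

Definition orth d v : 'rV[R]_3 := v - (dot v d / dot d d) *: d.

(* Internal dihedral angle of conv{X,Y,Z,W} at the edge XY. *)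
Definition dihedral X Y Z W : R :=
  angle (orth (Y - X) (Z - X)) (orth (Y - X) (W - X)).

(* [H] is spanned by the line XY and a direction [d], orthogonal to XY, which
   makes half of the dihedral angle with each of the two faces at XY. *)
Definition bisector_plane X Y Z W (H : set 'rV[R]_3) : Prop :=
  exists d, [/\ d != 0, dot d (Y - X) = 0,
    angle (orth (Y - X) (Z - X)) d = dihedral X Y Z W / 2,
    angle d (orth (Y - X) (W - X)) = dihedral X Y Z W / 2 &
    H = [set Q | exists a b : R, Q = X + a *: (Y - X) + b *: d]].

Definition open_segment X Y : set 'rV[R]_3 :=
  [set Q | exists t : R, 0 < t < 1 /\ Q = (1 - t) *: X + t *: Y].

End Euclidean.

(* A tetrahedron is given by its four vertices, the order of which is
   immaterial: [perm_eq T [:: X; Y; Z; W]] says that T = conv{X,Y,Z,W}. *)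
Notation tetra R := (4.-tuple 'rV[R]_3).

Section Tetrahedra.
Context {R : realType}.
Implicit Types (X Y Z W E : 'rV[R]_3) (T : tetra R) (D : seq (tetra R)).

Definition nondegenerate T : Prop :=
  row_free (\matrix_(i < 3) (tnth T (lift ord0 i) - tnth T ord0)).

(* The two sets below list each angle once per compatible vertex labelling. *)
Definition dihedral_angles T : set R :=
  [set th | exists X Y Z W,
     perm_eq T [:: X; Y; Z; W] /\ th = dihedral X Y Z W].

Definition face_angles T : set R :=
  [set th | exists X Y Z W,
     perm_eq T [:: X; Y; Z; W] /\ th = angle_at X Y Z].

(* The supremum is a maximum since the set is finite. *)
Definition Gamma T : R := sup (face_angles T `|` dihedral_angles T).

Definition largest_dihedral T X Y Z W : Prop :=
  perm_eq T [:: X; Y; Z; W] /\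
  forall X' Y' Z' W', perm_eq T [:: X'; Y'; Z'; W'] ->
    dihedral X' Y' Z' W' <= dihedral X Y Z W.

Definition unique_largest_dihedral T X Y Z W : Prop :=
  perm_eq T [:: X; Y; Z; W] /\
  forall X' Y' Z' W', perm_eq T [:: X'; Y'; Z'; W'] ->
    ~~ perm_eq [:: X'; Y'] [:: X; Y] ->
    dihedral X' Y' Z' W' < dihedral X Y Z W.

Definition lab_cut T T1 T2 : Prop :=
  nondegenerate T /\
  exists X Y Z W E, exists H : set 'rV[R]_3,
    [/\ largest_dihedral T X Y Z W,
        bisector_plane X Y Z W H,
        (H `&` open_segment Z W) E,
        perm_eq T1 [:: X; Y; Z; E] &
        perm_eq T2 [:: X; Y; E; W]].

Definition lab_child T T' : Prop :=
  exists T1 T2, lab_cut T T1 T2 /\ (T' = T1 \/ T' = T2).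

Definition nested_lab_branch (T0 : tetra R) (T : nat -> tetra R) : Prop :=
  T 0%N = T0 /\ forall n, lab_child (T n) (T n.+1).

Inductive obtained_by_lab_cuts (T0 : tetra R) : nat -> seq (tetra R) -> Prop :=
| no_lab_cut : obtained_by_lab_cuts T0 0 [:: T0]
| one_more_lab_cut n D1 D2 T T1 T2 :
    obtained_by_lab_cuts T0 n (D1 ++ T :: D2) -> lab_cut T T1 T2 ->
    obtained_by_lab_cuts T0 n.+1 (D1 ++ T1 :: T2 :: D2).

(* Nondegenerate tetrahedra with disjoint interiors are distinct, so
   [size D] is the number of tetrahedra of a partition [D]. The interior is
   the topological one; the sup norm and the Euclidean norm give the same
   topology. *)
Definition tetra_partition (T0 : tetra R) D : Prop :=
  [/\ forall T, T \in D -> nondegenerate T,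
      conv T0 = \bigcup_(T in [set` D]) conv T &
      forall i j, (i < j < size D)%N ->
        (conv (nth T0 D i))° `&` (conv (nth T0 D j))° = set0].

(* The common part is the hull of 0 (empty), 1 (vertex), 2 (edge) or 3 (face)
   common vertices. *)
Definition meet_in_common_face T T' : Prop :=
  exists s : seq 'rV[R]_3, [/\ uniq s, (size s <= 3)%N,
    {subset s <= T}, {subset s <= T'} & conv T `&` conv T' = conv s].

Definition conforming_partition (T0 : tetra R) D : Prop :=
  tetra_partition T0 D /\
  forall i j, (i < j < size D)%N ->
    meet_in_common_face (nth T0 D i) (nth T0 D j).

End Tetrahedra.

(* Main.v *)
From HB Require Import structures.
From mathcomp Require Import all_boot all_order all_algebra.
From mathcomp Require Import boolp classical_sets reals topology normedtype.
From mathcomp Require Import sequences trigo derive.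
From mathcomp Require Import ring lra.
Require Import Defs.

Set Implicit Arguments.
Unset Strict Implicit.
Unset Printing Implicit Defensive.
Import Order.TTheory GRing.Theory Num.Theory.
Import numFieldNormedType.Exports.
Local Open Scope classical_set_scope.
Local Open Scope ring_scope.

(** Each [T n] is a wedge: its vertices are the origin, a unit vector [P], and
    two points [p *: u] and [q *: v] on rays of the plane orthogonal to [P],
    where the unit vectors [u], [v] satisfy [dot u v = 7 / 8].  The plane that
    bisects the dihedral angle at an edge divides the opposite edge in the
    ratio of the areas of the two faces at that edge.  For the edge through
    [P] and [p *: u] these areas are [p / 2] and [slant p q / 2], so the cut
    meets the edge from [0] to [q *: v] at [cut_at p q *: v], with
    [cut_at p q = p * q / (p + slant p q)].  The child that keeps the edge
    from [0] to [P] is again a wedge, with legs [cut_at p q] and [p], and with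
    the two rays exchanged.

    Everything rests on one invariant of the pair of legs, [thin p q]: the
    ratio [p / q] lies in [[3/4, 4/5]] and [p <= 3/16].  If [P] were at
    infinity, [slant p q] would be the length of the third side of the base
    triangle, and the cut would act on [x = p / q] by the map
    [x -> 1 / (x + sqrt (x ^ 2 - 7/4 x + 1))], which sends [[3/4, 4/5]] into a
    range between [0.775] and [4/5]; the correction due to the finite height is
    of order [p ^ 2] and the bound on [p] keeps it below the slack ([thin_cut]).

    The invariant controls all angles: the dihedral angle at the edge from [P]
    to [p *: u] has cosine [(p - 7/8 q) / slant p q], which lies in
    [[-1/4, 0)], while the five other dihedral angles have cosines in
    [[0, 7/8]] ([thin_dihedral_PA], [thin_dihedral_other]).  So that edge is
    always the one to cut, and the angles stay between the bounds.  A face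
    angle can be obtuse only at [p *: u], where its cosine is at least [-1/4]
    ([thin_face_bounds]).

    The legs nevertheless shrink by a factor at most [4/5] at each cut, so the
    wedges collapse onto the segment from [0] to [P]: the diameter tends to
    [1], and the inradius is at most proportional to the legs, since the centre
    of an inscribed ball is at least its radius away from the two faces
    through that segment ([ball_in_wedge]).

    The partition of [T 0] consists of [T n] and of the siblings cut off on
    the way.  The sibling cut off at step [k] is separated by the new face
    from [T k.+1], which contains all later pieces.  A later piece meets this
    plane exactly in the hull of those of its vertices that lie on it, and
    these are vertices of the sibling ([cut_off_meets]). *)

(** * The Euclidean scalar product *)

Section ScalarProduct.
Context {R : realType}.
Implicit Types (u v w x : 'rV[R]_3) (X Y Z W E Q : 'rV[R]_3).

Lemma dotC u v : dot u v = dot v u.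
Proof. by apply: eq_bigr => i _; rewrite mulrC. Qed.

Lemma dotDl u v w : dot (u + v) w = dot u w + dot v w.
Proof. by rewrite -big_split; apply: eq_bigr => i _; rewrite !mxE mulrDl. Qed.

Lemma dotZl a u w : dot (a *: u) w = a * dot u w.
Proof. by rewrite mulr_sumr; apply: eq_bigr => i _; rewrite !mxE mulrA. Qed.

Lemma dotNl u w : dot (- u) w = - dot u w.
Proof. by rewrite -scaleN1r dotZl mulN1r. Qed.

Lemma dotBl u v w : dot (u - v) w = dot u w - dot v w.
Proof. by rewrite dotDl dotNl. Qed.

Lemma dot0l w : dot 0 w = 0.
Proof. by rewrite -(scale0r (0 : 'rV_3)) dotZl mul0r. Qed.

Lemma dotDr u v w : dot w (u + v) = dot w u + dot w v.
Proof. by rewrite dotC dotDl 2!(dotC w). Qed.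

Lemma dotZr a u w : dot w (a *: u) = a * dot w u.
Proof. by rewrite dotC dotZl dotC. Qed.

Lemma dotNr u w : dot w (- u) = - dot w u.
Proof. by rewrite dotC dotNl dotC. Qed.

Lemma dotBr u v w : dot w (u - v) = dot w u - dot w v.
Proof. by rewrite dotDr dotNr. Qed.

Lemma dot0r w : dot w 0 = 0.
Proof. by rewrite dotC dot0l. Qed.

Definition dotE := (dotDl, dotDr, dotNl, dotNr, dotZl, dotZr, dot0l, dot0r).

Lemma dot_ge0 u : 0 <= dot u u.
Proof. by apply: sumr_ge0 => i _; rewrite -expr2 sqr_ge0. Qed.

Lemma dot_eq0 u : (dot u u == 0) = (u == 0).
Proof.
apply/eqP/eqP => [|->]; last by rewrite dot0l.
move=> /psumr_eq0P u0; apply/rowP => i; rewrite mxE.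
by apply/eqP; rewrite -sqrf_eq0 expr2 u0// => j _; rewrite -expr2 sqr_ge0.
Qed.

Lemma enorm_ge0 u : 0 <= enorm u. Proof. exact: sqrtr_ge0. Qed.

Lemma sqr_enorm u : enorm u ^+ 2 = dot u u.
Proof. by rewrite sqr_sqrtr ?dot_ge0. Qed.

Lemma enorm_gt0 u : (0 < enorm u) = (u != 0).
Proof. by rewrite sqrtr_gt0 lt0r dot_eq0 dot_ge0 andbT. Qed.

Lemma enormZ a u : enorm (a *: u) = `|a| * enorm u.
Proof. by rewrite /enorm !dotE mulrA -expr2 sqrtrM ?sqr_ge0// sqrtr_sqr. Qed.

Lemma enormE u a : 0 <= a -> dot u u = a ^+ 2 -> enorm u = a.
Proof. by move=> a0 e; rewrite /enorm e sqrtr_sqr ger0_norm. Qed.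

Lemma dot_le_enorm u v : dot u v <= enorm u * enorm v.
Proof.
have [->|u0] := eqVneq u 0; first by rewrite dot0l mulr_ge0 ?enorm_ge0.
have [->|v0] := eqVneq v 0; first by rewrite dot0r mulr_ge0 ?enorm_ge0.
have := dot_ge0 (enorm v *: u - enorm u *: v).
rewrite !dotE -!sqr_enorm (dotC v u); move: u0 v0; rewrite -!enorm_gt0.
move: (enorm u) (enorm v) (dot u v) => a b c a0 b0 h.
rewrite -subr_ge0 -(pmulr_rge0 _ (mulr_gt0 a0 b0)).
lra.
Qed.

Lemma normr_dot_le u v : `|dot u v| <= enorm u * enorm v.
Proof.
rewrite ler_norml dot_le_enorm andbT lerNl -dotNl.
by rewrite -[enorm u]mul1r -(normrN1 R) -enormZ scaleN1r dot_le_enorm.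
Qed.

Lemma cosine_itv u v : -1 <= dot u v / (enorm u * enorm v) <= 1.
Proof.
rewrite -ler_norml normrM normfV (ger0_norm (mulr_ge0 _ _)) ?enorm_ge0//.
have [->|uv0] := eqVneq (enorm u * enorm v) 0; first by rewrite invr0 mulr0.
rewrite ler_pdivrMr ?mul1r ?normr_dot_le//.
by rewrite lt0r uv0 mulr_ge0 ?enorm_ge0.
Qed.

Lemma ltr_acos : {in `[-1, 1] &, {mono (@acos R) : x y /~ x < y}}.
Proof.
move=> x y xI yI; rewrite -ltr_cos ?acosK//.
  by rewrite in_itv /= acos_ge0 ?acos_lepi// -?(in_itv _ x).
by rewrite in_itv /= acos_ge0 ?acos_lepi// -?(in_itv _ x).
Qed.

Lemma ler_acos : {in `[-1, 1] &, {mono (@acos R) : x y /~ x <= y}}.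
Proof. by move=> x y xI yI; rewrite leNgt ltr_acos// -leNgt. Qed.

(** The half-angle formula: the square root is the nonnegative value of
    [cos (acos c / 2)]. *)
Lemma acos_half (c : R) : -1 <= c <= 1 ->
  acos (Num.sqrt ((1 + c) / 2)) = acos c / 2.
Proof.
move=> cI; have [/andP[a0 api] ac] := acos_def cI.
have hI : acos c / 2 \in `[0, pi].
  by rewrite in_itv /=; apply/andP; split; lra.
have hI2 : -(pi/2) <= acos c / 2 <= pi/2.
  by apply/andP; split; have := pi_ge0 R; lra.
rewrite -[RHS](cosK hI); congr acos.
rewrite -[RHS]ger0_norm ?cos_ge0_pihalf// -sqrtr_sqr; congr Num.sqrt.
rewrite -[in LHS]ac {1}(splitr (acos c)) -mulr2n cos_mulr2n.
by rewrite mulr2n; field.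
Qed.

End ScalarProduct.

(** * Convex hulls *)

Section Hulls.
Context {R : realType}.
Implicit Types (m X Y Z W E Q : 'rV[R]_3) (s t : seq 'rV[R]_3) (c : R).

(** The hull with total weight [c] in place of 1.  Taking one vertex away
    lowers the total weight, so inductions on [s] need an arbitrary [c];
    [cone s 1] is [conv s]. *)
Definition cone s c : set 'rV[R]_3 :=
  [set Q | exists a : nat -> R, [/\ forall i, 0 <= a i,
     \sum_(i < size s) a i = c & Q = \sum_(i < size s) a i *: s`_i]].

Lemma cone_nil c Q : cone [::] c Q <-> c = 0 /\ Q = 0.
Proof.
split=> [[a [_]]|[-> ->]]; first by rewrite !big_ord0 => <- ->.
by exists (fun=> 0); split; rewrite ?big_ord0.
Qed.

Lemma cone_cons X s c Q :
  cone (X :: s) c Q <-> exists2 r, 0 <= r & cone s (c - r) (Q - r *: X).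
Proof.
split=> [[a [a0]]|[r r0 [a [a0 sa QE]]]].
  rewrite /= !big_ord_recl /= => <- ->; exists (a 0%N) => //.
  exists (fun i => a i.+1); split => //; first by rewrite [RHS]addrC addKr.
  by rewrite [LHS]addrC addKr.
exists (fun i => if i is j.+1 then a j else r); split.
- by case.
- by rewrite /= big_ord_recl /= sa addrC subrK.
- by rewrite /= big_ord_recl /= -QE addrC subrK.
Qed.

Lemma coneD s c c' Q Q' : cone s c Q -> cone s c' Q' -> cone s (c + c') (Q + Q').
Proof.
move=> [a [a0 <- ->]] [b [b0 <- ->]]; exists (fun i => a i + b i).
split; [by move=> i; rewrite addr_ge0|by rewrite big_split|].
by rewrite -big_split; apply: eq_bigr => i _; rewrite scalerDl.
Qed.

Lemma coneZ s c r Q : 0 <= r -> cone s c Q -> cone s (r * c) (r *: Q).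
Proof.
move=> r0 [a [a0 <- ->]]; exists (fun i => r * a i); split.
- by move=> i; rewrite mulr_ge0.
- by rewrite mulr_sumr.
- by rewrite scaler_sumr; apply: eq_bigr => i _; rewrite scalerA.
Qed.

Lemma cone0 s : cone s 0 0.
Proof.
exists (fun=> 0); split => //; first by rewrite big1.
by rewrite big1 // => i _; rewrite scale0r.
Qed.

Lemma conv_vertex s X : X \in s -> conv s X.
Proof.
change (X \in s -> cone s 1 X); elim: s => // Y s ih.
rewrite in_cons => /predU1P[->|/ih Xs]; apply/cone_cons.
  by exists 1; rewrite // scale1r !subrr; exact: cone0.
by exists 0; rewrite // scale0r !subr0.
Qed.

Lemma conv_min s t : {in s, forall X, conv t X} -> conv s `<=` conv t.
Proof.
move=> st; suff h c Q : cone s c Q -> cone t c Q by exact: h.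
elim: s st c Q => [_ c Q /cone_nil[-> ->]|X s ih st c Q]; first exact: cone0.
move=> /cone_cons[r r0 /ih h].
rewrite -(subrK (r * 1) c) -(subrK (r *: X) Q); apply: coneD.
  by rewrite mulr1; apply: h => Y Ys; apply: st; rewrite in_cons Ys orbT.
by apply: coneZ => //; apply: st; rewrite mem_head.
Qed.

Lemma sub_conv s t : {subset s <= t} -> conv s `<=` conv t.
Proof. by move=> st; apply: conv_min => X /st; exact: conv_vertex. Qed.

Lemma perm_conv s t : perm_eq s t -> conv s = conv t.
Proof.
by move=> /perm_mem st; apply/seteqP; split; apply: sub_conv => X; rewrite st.
Qed.

Lemma conv2P X Y Q : conv [:: X; Y] Q <->
  exists a b, [/\ 0 <= a, 0 <= b, a + b = 1 & Q = a *: X + b *: Y].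
Proof.
split=> [[a [a0]]|[a [b [a0 b0 ab ->]]]].
  rewrite /= !big_ord_recl !big_ord0 /= !addr0 => a1 ->.
  by exists (a 0%N), (a 1%N).
exists (nth 0 [:: a; b]); split; first by case=> [|[|[]]].
  by rewrite /= !big_ord_recl big_ord0 /= !addr0.
by rewrite /= !big_ord_recl big_ord0 /= !addr0.
Qed.

Lemma conv4P X Y Z W Q : conv [:: X; Y; Z; W] Q <->
  exists a b c d, [/\ [/\ 0 <= a, 0 <= b, 0 <= c & 0 <= d],
    a + b + c + d = 1 & Q = a *: X + b *: Y + c *: Z + d *: W].
Proof.
split=> [[a [a0]]|[a [b [c [d [[a0 b0 c0 d0] abcd ->]]]]]].
  rewrite /= !big_ord_recl !big_ord0 /= !addr0 !addrA => a1 ->.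
  by exists (a 0%N), (a 1%N), (a 2%N), (a 3%N).
exists (nth 0 [:: a; b; c; d]); split; first by case=> [|[|[|[|[]]]]].
  by rewrite /= !big_ord_recl big_ord0 /= !addr0 !addrA.
by rewrite /= !big_ord_recl big_ord0 /= !addr0 !addrA.
Qed.

Lemma cone_le m k s c Q :
  {in s, forall X, dot m X <= k} -> cone s c Q -> dot m Q <= c * k.
Proof.
elim: s c Q => [|X s ih] c Q ms; first by move=> /cone_nil[-> ->]; rewrite dot0r mul0r.
move=> /cone_cons[r r0 /ih]; rewrite !dotE.
have mX : r * dot m X <= r * k by rewrite ler_wpM2l ?ms ?mem_head.
have ms' : {in s, forall Y, dot m Y <= k}.
  by move=> Y Ys; rewrite ms// in_cons Ys orbT.
by move=> /(_ ms'); lra.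
Qed.

Lemma conv_le m k s Q : {in s, forall X, dot m X <= k} -> conv s Q -> dot m Q <= k.
Proof. by move=> ms /(cone_le ms); rewrite mul1r. Qed.

Lemma conv_ge m k s Q : {in s, forall X, k <= dot m X} -> conv s Q -> k <= dot m Q.
Proof.
move=> ms sQ; rewrite -lerN2 -dotNl; apply: conv_le sQ => X /ms.
by rewrite dotNl lerN2.
Qed.

(** Since [dot m Q] is the weighted mean of the [dot m X], it can reach the
    upper bound [k] only if the vertices with [dot m X < k] have weight 0. *)
Lemma cone_exposed m k s c Q : {in s, forall X, dot m X <= k} ->
  cone s c Q -> c * k <= dot m Q -> cone [seq X <- s | dot m X == k] c Q.
Proof.
elim: s c Q => [//|X s ih] c Q ms /cone_cons[r r0 sQ] mQ /=.
have ms' : {in s, forall Y, dot m Y <= k}.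
  by move=> Y Ys; rewrite ms// in_cons Ys orbT.
have mXk : dot m X <= k by rewrite ms ?mem_head.
have mX : r * dot m X <= r * k by rewrite ler_wpM2l.
have := cone_le ms' sQ; rewrite !dotE => sQle.
have mQ' : cone [seq Y <- s | dot m Y == k] (c - r) (Q - r *: X).
  by apply: ih => //; rewrite !dotE; lra.
case: ifPn => [_|mX_neq]; first by apply/cone_cons; exists r.
suff r00 : r = 0 by move: mQ'; rewrite r00 scale0r !subr0.
apply/eqP; rewrite eq_le r0 andbT leNgt; apply/negP => r_gt0.
have : r * dot m X < r * k by rewrite ltr_pM2l// lt_neqAle mX_neq.
lra.
Qed.

(** Two polytopes on opposite sides of a plane meet inside this plane, and the
    trace of [conv s] on it is spanned by vertices of [s].  If these are
    vertices of [t] as well, the intersection is their hull. *)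
Lemma separated_meet m k s t :
    {in s, forall X, dot m X <= k} -> {in t, forall X, k <= dot m X} ->
    {in s, forall X, dot m X = k -> X \in t} ->
  conv s `&` conv t = conv [seq X <- s | dot m X == k].
Proof.
move=> ms mt st; apply/seteqP; split=> [Q [sQ tQ]|Q sQ].
  by apply: cone_exposed sQ _ => //; rewrite mul1r; exact: conv_ge tQ.
split; apply: sub_conv sQ => X; rewrite mem_filter => /andP[] // /eqP mX Xs.
exact: st.
Qed.

(** A point of both interiors lies on the plane [dot m Q = k], and so does a
    small translate of it along the normal [m]: a contradiction. *)
Lemma separated_interior m k (A B : set 'rV[R]_3) : m != 0 ->
    (forall Q, A Q -> dot m Q <= k) -> (forall Q, B Q -> k <= dot m Q) ->
  A° `&` B° = set0.
Proof.
move=> m0 mA mB; apply/seteqP; split=> // Q [AQ BQ].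
have ABQ : nbhs Q (A `&` B) by exact: filterI.
have mE Q' : (A `&` B) Q' -> dot m Q' = k.
  by move=> [/mA h1 /mB h2]; apply/eqP; rewrite eq_le h1.
have g_cvg : (fun r : R => Q + r *: m) r @[r --> 0] --> Q.
  rewrite -[X in _ --> X]addr0 -(scale0r m).
  by apply: cvgD; [exact: cvg_cst|apply: cvgZl; exact: cvg_id].
have /nbhs_ballP[e e0 eAB] := g_cvg _ ABQ.
have e2 : ball (0 : R) e (e / 2).
  rewrite -ball_normE /= sub0r normrN gtr0_norm ?divr_gt0//.
  by rewrite ltr_pdivrMr// ltr_pMr// ltr1n.
have := mE _ (eAB _ e2); have := mE _ (nbhs_singleton ABQ).
rewrite /= !dotE => ->.
have : 0 < e / 2 * dot m m by rewrite mulr_gt0 ?divr_gt0// lt0r dot_eq0 m0 dot_ge0.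
lra.
Qed.

(** A point lies in the half with [Z] when its weights at [Z] and [W] are in a
    ratio at least that of the weights of [E]; then all the weight of [W] can be
    moved to [E]. *)
Lemma conv_split X Y Z W E : open_segment Z W E ->
  conv [:: X; Y; Z; W] = conv [:: X; Y; Z; E] `|` conv [:: X; Y; E; W].
Proof.
move=> [r [/andP[r0 r1] EE]].
have r1' : 0 < 1 - r by rewrite subr_gt0.
have rn : r != 0 by rewrite gt_eqF.
have rn1 : 1 - r != 0 by rewrite gt_eqF.
have ZWE : conv [:: X; Y; Z; W] E.
  apply/conv4P; exists 0, 0, (1 - r), r; split; last by rewrite !scale0r !add0r.
    by split; rewrite // ltW.
  by rewrite !add0r subrK.
apply/seteqP; split=> [Q|Q [|]]; last 2 first.
- apply: conv_min => V; rewrite !inE => /or4P[] /eqP -> //;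
    by apply: conv_vertex; rewrite !inE eqxx ?orbT.
- apply: conv_min => V; rewrite !inE => /or4P[] /eqP -> //;
    by apply: conv_vertex; rewrite !inE eqxx ?orbT.
move=> /conv4P[a [b [c [d [[a0 b0 c0 d0] abcd ->]]]]].
have [cd|cd] := lerP (d * (1 - r)) (c * r); [left|right]; apply/conv4P.
- exists a, b, (c - d * (1 - r) / r), (d / r); split.
  + by rewrite subr_ge0 ler_pdivrMr// divr_ge0 ?(ltW r0)//.
  + by rewrite -[RHS]abcd; field.
  + rewrite EE; apply/rowP => i; rewrite !mxE; field. exact: rn.
- exists a, b, (c / (1 - r)), (d - c * r / (1 - r)); split.
  + by rewrite subr_ge0 ler_pdivrMr// (ltW cd) divr_ge0 ?(ltW r1')//.
  + by rewrite -[RHS]abcd; field.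
  + rewrite EE; apply/rowP => i; rewrite !mxE; field. exact: rn1.
Qed.

End Hulls.

(** * Dihedral angles and bisecting cuts *)

(** Up to the two exchanges, a labelling of a tetrahedron by [x], [y], [z],
    [w] amounts to the choice of the edge [{x, y}], hence six cases. *)
Lemma perm4_ind (T : eqType) (Phi : T -> T -> T -> T -> Prop) (a b c d : T) :
    (forall x y z w, Phi x y z w -> Phi y x z w) ->
    (forall x y z w, Phi x y z w -> Phi x y w z) ->
    Phi a b c d -> Phi a c b d -> Phi a d b c ->
    Phi b c a d -> Phi b d a c -> Phi c d a b ->
  forall x y z w, perm_eq [:: a; b; c; d] [:: x; y; z; w] -> Phi x y z w.
Proof.
move=> S1 S2 ab ac ad bc bd cd x y z w; rewrite perm_sym => /(perm_iotaP a)[Is].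
rewrite -mem_permutations.
(* The 24 permutations of the indices are listed by computation. *)
have -> : permutations (iota 0 (size [:: a; b; c; d])) =
   ltac:(let l := eval vm_compute in (permutations (iota 0 4)) in exact l) by [].
rewrite !inE.
by do ! [case/orP]; move=> /eqP-> [-> -> -> ->]; auto 6.
Qed.

Section Angles.
Context {R : realType}.
Implicit Types (d u v z w : 'rV[R]_3) (X Y Z W E Q : 'rV[R]_3).

Lemma dot_orth d u v : d != 0 ->
  dot (orth d u) (orth d v) = dot u v - dot u d * dot v d / dot d d.
Proof.
by rewrite -dot_eq0 => d0; rewrite /orth !dotE (dotC d v); field.
Qed.

Lemma angleC u v : angle u v = angle v u.
Proof. by rewrite /angle dotC (mulrC (enorm u)). Qed.

Lemma dihedral_swap_faces X Y Z W : dihedral X Y W Z = dihedral X Y Z W.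
Proof. exact: angleC. Qed.

Lemma orth_opp d v : orth (- d) (v - d) = orth d v.
Proof.
have [->|] := eqVneq d 0; first by rewrite oppr0 addr0.
rewrite -dot_eq0 => d0; rewrite /orth !dotE.
by apply/rowP => i; rewrite !mxE; field.
Qed.

Lemma dihedral_swap_ends X Y Z W : dihedral Y X Z W = dihedral X Y Z W.
Proof.
rewrite /dihedral -(opprB Y X).
have e V : V - Y = (V - X) - (Y - X) by rewrite opprB addrA subrK.
by rewrite (e Z) (e W) !orth_opp.
Qed.

Lemma angle_le a u v : -1 <= a <= 0 -> a * (enorm u * enorm v) <= dot u v ->
  angle u v <= acos a.
Proof.
move=> /andP[a1 a0] auv; rewrite /angle ler_acos ?in_itv/= ?cosine_itv//; last first.
  by apply/andP; split; lra.
have [e|e] := eqVneq (enorm u * enorm v) 0; first by rewrite e invr0 mulr0.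
by rewrite ler_pdivlMr// lt0r e mulr_ge0 ?enorm_ge0.
Qed.

Lemma angle_cos u v c : dot u v = c * (enorm u * enorm v) ->
  0 < enorm u -> 0 < enorm v -> angle u v = acos c.
Proof. by move=> e u0 v0; rewrite /angle e mulfK// mulf_neq0 ?gt_eqF. Qed.

(** Condition [(1 - r) * enorm z = r * enorm w] makes [d] a positive multiple
    of the sum of the unit vectors along [z] and [w], that is, of the
    diagonal of a rhombus.  The hypothesis on [dot z w] excludes opposite
    vectors, for which [d] vanishes. *)
Lemma bisecting_direction z w r :
    let d := (1 - r) *: z + r *: w in
    0 < r -> 0 < enorm z -> 0 < enorm w -> - (enorm z * enorm w) < dot z w ->
    (1 - r) * enorm z = r * enorm w ->
  [/\ d != 0, angle z d = angle z w / 2 & angle d w = angle z w / 2].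
Proof.
move=> d r0 z0 w0 zw rzw; pose n := r * enorm w.
have n0 : 0 < n by rewrite mulr_gt0.
pose c := dot z w / (enorm z * enorm w).
have zwE : dot z w = c * (enorm z * enorm w) by rewrite divfK// mulf_neq0 ?gt_eqF.
have c1 : 0 < 1 + c by move: zw; rewrite zwE; move: (mulr_gt0 z0 w0); nra.
have cI : -1 <= c <= 1 by exact: cosine_itv.
have thetaE : angle z w = acos c by [].
clearbody c.
have rz : 1 - r = n / enorm z by rewrite /n -rzw mulfK ?gt_eqF.
have rw : r = n / enorm w by rewrite /n mulfK ?gt_eqF.
clearbody n.
have dd : dot d d = n ^+ 2 * (2 * (1 + c)).
  rewrite /d rz [in X in _ + X]rw !dotE (dotC w z) zwE -!sqr_enorm.
  by field; rewrite !gt_eqF.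
pose k := Num.sqrt ((1 + c) / 2).
have k2 : k ^+ 2 = (1 + c) / 2 by rewrite sqr_sqrtr// divr_ge0// ltW.
have k0 : 0 < k by rewrite sqrtr_gt0 divr_gt0.
have dE : enorm d = n * 2 * k.
  apply: enormE; first by rewrite !mulr_ge0// ltW.
  by rewrite dd exprMn k2; field.
have d0 : 0 < enorm d by rewrite dE !mulr_gt0.
have cE : c = 2 * k ^+ 2 - 1 by rewrite k2; field.
split; first by rewrite -enorm_gt0.
- rewrite thetaE -acos_half// -/k; apply: angle_cos => //.
  rewrite dE [in LHS]/d rz [in X in _ + X]rw !dotE zwE -!sqr_enorm cE.
  by field; rewrite !gt_eqF.
- rewrite thetaE -acos_half// -/k; apply: angle_cos => //.
  rewrite dE [in LHS]/d rz [in X in _ + X]rw !dotE zwE -!sqr_enorm cE.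
  by field; rewrite !gt_eqF.
Qed.

(** The norms of [z] and [w] are the distances of [Z] and [W] to the line XY,
    so they are in the ratio of the areas of the faces XYZ and XYW, and the
    cut divides ZW in this ratio.  The component of [E - X] orthogonal to XY is
    then a bisecting direction. *)
Lemma lab_cut_along_bisector (T T1 T2 : tetra R) X Y Z W r :
    let z := orth (Y - X) (Z - X) in let w := orth (Y - X) (W - X) in
    let E := (1 - r) *: Z + r *: W in
    nondegenerate T -> largest_dihedral T X Y Z W -> Y - X != 0 -> 0 < r < 1 ->
    0 < enorm z -> 0 < enorm w -> - (enorm z * enorm w) < dot z w ->
    (1 - r) * enorm z = r * enorm w ->
    perm_eq T1 [:: X; Y; Z; E] -> perm_eq T2 [:: X; Y; E; W] ->
  lab_cut T T1 T2.
Proof.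
move=> z w E ndT maxT XY r01 z0 w0 zw rzw T1E T2E; split=> //.
have /andP[r0 r1] := r01.
have [d0 zd dw] := bisecting_direction r0 z0 w0 zw rzw.
exists X, Y, Z, W, E.
exists [set Q | exists a b : R,
  Q = X + a *: (Y - X) + b *: ((1 - r) *: z + r *: w)].
split=> //.
- eexists; split; first exact: d0; [|exact: zd|exact: dw|by []].
  rewrite /z /w /orth; move: (Y - X) XY => D D0.
  by rewrite !dotE; field; rewrite dot_eq0.
- split; last by exists r.
  exists ((1 - r) * (dot (Z - X) (Y - X) / dot (Y - X) (Y - X)) +
     r * (dot (W - X) (Y - X) / dot (Y - X) (Y - X))), 1.
  rewrite scale1r /z /w /orth /E; apply/rowP => i; rewrite !mxE.
  by ring.
Qed.

Lemma atan_le (x : R) : 0 <= x -> atan x <= x.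
Proof.
move=> x0; have [->|xn0] := eqVneq x 0; first by rewrite atan0.
have {}x0 : 0 < x by rewrite lt0r xn0.
have datan y : y \in `]0, x[ -> is_derive y 1 (@atan R) (1 + y ^+ 2)^-1.
  by move=> _; exact: is_derive1_atan.
have catan : {within `[0, x], continuous (@atan R)}.
  by apply: continuous_subspaceT => y; exact: continuous_atan.
have [c _] := MVT x0 datan catan.
rewrite atan0 !subr0 => ->; rewrite ler_piMl ?(ltW x0)// invf_le1 ?lerDl ?sqr_ge0//.
by rewrite ltr_pwDl ?sqr_ge0.
Qed.

Lemma angle_atan u v x : 0 <= x -> 0 < enorm u -> 0 < enorm v ->
  dot u v * Num.sqrt (1 + x ^+ 2) = enorm u * enorm v -> angle u v = atan x.
Proof.
move=> x0 u0 v0 e.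
rewrite -[RHS]cosK; last first.
  rewrite in_itv /= -atan0 le_atan//=.
  by apply: le_trans (ltW (atan_ltpi2 _)) _; have := pi_ge0 R; lra.
rewrite cos_atan; apply: angle_cos => //.
by rewrite -e mulrC mulfK// gt_eqF// sqrtr_gt0 ltr_pwDl ?sqr_ge0.
Qed.

End Angles.

(** * Dihedral angles of a wedge *)

Section Wedge.
Context {R : realType}.
Implicit Types (P u v A B Q X Y Z W : 'rV[R]_3) (p q : R).

(** The edge from [0] to [P], common to all the tetrahedra of the branch, and
    the two rays that carry the other vertices.  The frame stays abstract and
    symmetric in [u] and [v] ([wedge_frame_sym]) because each cut exchanges
    the two rays. *)
Definition wedge_frame P u v : Prop :=
  [/\ dot u u = 1, dot v v = 1, dot u v = 7 / 8 & dot P P = 1] /\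
  [/\ dot P u = 0, dot P v = 0 &
      forall Q, exists x y z, Q = x *: u + y *: v + z *: P].

Lemma wedge_frame_sym P u v : wedge_frame P u v -> wedge_frame P v u.
Proof.
move=> [[uu vv uv PP] [Pu Pv span]]; split; first by split; rewrite // dotC.
by split=> // Q; have [x [y [z ->]]] := span Q; exists y, x, z; rewrite (addrC (_ *: v)).
Qed.

Lemma wedge_frame_dot P u v : wedge_frame P u v ->
  (dot u u = 1) * (dot v v = 1) * (dot u v = 7 / 8) * (dot v u = 7 / 8) *
  (dot P P = 1) * (dot P u = 0) * (dot P v = 0) * (dot u P = 0) * (dot v P = 0).
Proof. by move=> [[? ? ? ?] [? ? _]]; rewrite !(dotC _ P) (dotC v u). Qed.

(** The vector dual to [u] in the basis [u], [v], [P]: it computes the first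
    oblique coordinate, and it is normal to the face through [0], [P] and
    [v]. *)
Definition dual u v := (64 / 15) *: u - (56 / 15) *: v.

Lemma dual_dot P u v : wedge_frame P u v ->
  (dot (dual u v) u = 1) * (dot (dual u v) v = 0) * (dot (dual u v) P = 0) *
  (dot (dual v u) v = 1) * (dot (dual v u) u = 0) * (dot (dual v u) P = 0).
Proof.
by move=> F; rewrite /dual !dotE !(wedge_frame_dot F); do !split; field.
Qed.

Lemma enorm_dual P u v : wedge_frame P u v -> enorm (dual u v) = 8 / Num.sqrt 15.
Proof.
move=> F; apply: enormE; first by rewrite divr_ge0 ?sqrtr_ge0.
by rewrite /dual !dotE !(wedge_frame_dot F) expr_div_n sqr_sqrtr//; field.
Qed.

Lemma wedge_frame_free P u v x y z : wedge_frame P u v ->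
  x *: u + y *: v + z *: P = 0 -> [/\ x = 0, y = 0 & z = 0].
Proof.
move=> F xyz; have := congr1 (dot P) xyz.
have := congr1 (dot (dual v u)) xyz; have := congr1 (dot (dual u v)) xyz.
rewrite !dotDr !dotZr !dot0r !(wedge_frame_dot F) !(dual_dot F).
by move=> h1 h2 h3; split; lra.
Qed.

Lemma nondegenerate_free X Y Z W :
  (forall x y z : R, x *: (Y - X) + y *: (Z - X) + z *: (W - X) = 0 ->
     [/\ x = 0, y = 0 & z = 0]) -> nondegenerate [tuple X; Y; Z; W].
Proof.
move=> free; apply: inj_row_free => a; rewrite mulmx_sum_row.
rewrite !big_ord_recl big_ord0 !rowK addr0 addrA => /free[a0 a1 a2].
apply/rowP => i; rewrite mxE.
case: i => [[|[|[|//]]] lti]; [move: a0|move: a1|move: a2] => <-;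
  by congr (a _ _); apply: val_inj.
Qed.

Lemma nondegenerate_wedge P u v p q : wedge_frame P u v -> 0 < p -> 0 < q ->
  nondegenerate [tuple 0; P; p *: u; q *: v].
Proof.
move=> F p0 q0; apply: nondegenerate_free => x y z e.
have [|py0 qz0 x0] := @wedge_frame_free P u v (y * p) (z * q) x F.
  by rewrite -[RHS]e; apply/rowP => i; rewrite !mxE; ring.
split=> //; apply/eqP.
  by move/eqP: py0; rewrite mulf_eq0 (gt_eqF p0) orbF.
by move/eqP: qz0; rewrite mulf_eq0 (gt_eqF q0) orbF.
Qed.

Lemma nondegenerate_cut P u v p q e : wedge_frame P u v -> 0 < p -> e < q ->
  nondegenerate [tuple P; p *: u; e *: v; q *: v].
Proof.
move=> F p0 eq; apply: nondegenerate_free => x y z xyz.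
have [|px0 eqz0 xyz0] := @wedge_frame_free P u v (x * p) (y * e + z * q) (- (x + y + z)) F.
  by rewrite -[RHS]xyz; apply/rowP => i; rewrite !mxE; ring.
have x0 : x = 0.
  by apply/eqP; move/eqP: px0; rewrite mulf_eq0 (gt_eqF p0) orbF.
have yz : y = - z by lra.
suff z0 : z = 0 by rewrite yz z0 oppr0.
have : z * (q - e) = 0 by rewrite -[RHS]eqz0 yz; ring.
by move/eqP; rewrite mulf_eq0 subr_eq0 (gt_eqF eq) orbF => /eqP.
Qed.

(** Twice the area of the triangle with vertices [P], [p *: u], [q *: v].  The
    first three terms are the square of the side opposite to [P], the last one
    is the square of twice the area of the base. *)
Definition slant p q :=
  Num.sqrt (p ^+ 2 + q ^+ 2 - 7 / 4 * (p * q) + 15 / 64 * (p ^+ 2 * q ^+ 2)).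

Lemma slantC p q : slant p q = slant q p.
Proof. by congr Num.sqrt; ring. Qed.

Lemma sqr_slant p q : slant p q ^+ 2 =
  p ^+ 2 + q ^+ 2 - 7 / 4 * (p * q) + 15 / 64 * (p ^+ 2 * q ^+ 2).
Proof.
apply: sqr_sqrtr; have := sqr_ge0 (p - 7 / 8 * q); have := sqr_ge0 q.
have := sqr_ge0 (p * q); rewrite exprMn; nra.
Qed.

Lemma slant_gt0 p q : q != 0 -> 0 < slant p q.
Proof.
move=> q0; rewrite lt0r sqrtr_ge0 andbT -sqrf_eq0 sqr_slant gt_eqF//.
have : 0 < q ^+ 2 by rewrite lt0r sqrf_eq0 q0 sqr_ge0.
have := sqr_ge0 (p - 7 / 8 * q).
have := sqr_ge0 (p * q); rewrite exprMn; nra.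
Qed.

(** The two norms are the distances of [0] and [q *: v] to the line through
    [P] and [p *: u], and [k] is the distance from [P] to [p *: u]. *)
Lemma orth_PA P u v p q : wedge_frame P u v -> 0 < p -> 0 < q ->
  let z := orth (p *: u - P) (0 - P) in let w := orth (p *: u - P) (q *: v - P) in
  let k := Num.sqrt (1 + p ^+ 2) in
  [/\ enorm z = p / k, enorm w = slant p q / k &
      dot z w = p * (p - 7 / 8 * q) / k ^+ 2].
Proof.
move=> F p0 q0 z w k.
have k2 : k ^+ 2 = 1 + p ^+ 2 by rewrite sqr_sqrtr// addr_ge0 ?sqr_ge0.
have k2p : 0 < 1 + p ^+ 2 by rewrite ltr_pwDl ?sqr_ge0.
have k0 : 0 <= k by exact: sqrtr_ge0.
have dd : dot (p *: u - P) (p *: u - P) = 1 + p ^+ 2.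
  by rewrite !dotE !(wedge_frame_dot F); ring.
have d0 : p *: u - P != 0 by rewrite -dot_eq0 dd gt_eqF.
rewrite /z /w; split.
- apply: enormE; first by rewrite divr_ge0// ltW.
  rewrite dot_orth// dd !dotE !(wedge_frame_dot F) expr_div_n k2.
  by field; rewrite gt_eqF.
- apply: enormE; first by rewrite divr_ge0// sqrtr_ge0.
  rewrite dot_orth// dd !dotE !(wedge_frame_dot F) expr_div_n k2 sqr_slant.
  by field; rewrite gt_eqF.
- rewrite dot_orth// dd !dotE !(wedge_frame_dot F) k2.
  by field; rewrite gt_eqF.
Qed.

Lemma dihedral_PA P u v p q : wedge_frame P u v -> 0 < p -> 0 < q ->
  dihedral P (p *: u) 0 (q *: v) = acos ((p - 7 / 8 * q) / slant p q).
Proof.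
move=> F p0 q0; have [zE wE zw] := orth_PA F p0 q0.
have s0 : 0 < slant p q by rewrite slant_gt0// gt_eqF.
have k0 : 0 < Num.sqrt (1 + p ^+ 2) by rewrite sqrtr_gt0 ltr_pwDl ?sqr_ge0.
apply: angle_cos; rewrite ?zE ?wE ?zw ?divr_gt0//.
by field; rewrite !gt_eqF.
Qed.

Lemma dihedral_OP P u v p q : wedge_frame P u v -> 0 < p -> 0 < q ->
  dihedral 0 P (p *: u) (q *: v) = acos (7 / 8).
Proof.
move=> F p0 q0; have o a x : dot P x = 0 -> orth (P - 0) (a *: x - 0) = a *: x.
  by move=> Px; rewrite /orth !subr0 !dotE dotC Px mulr0 mul0r scale0r subr0.
rewrite /dihedral !o ?(wedge_frame_dot F)//.
have up : enorm (p *: u) = p.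
  by apply: enormE; [exact: ltW|rewrite !dotE !(wedge_frame_dot F); ring].
have vq : enorm (q *: v) = q.
  by apply: enormE; [exact: ltW|rewrite !dotE !(wedge_frame_dot F); ring].
by apply: angle_cos; rewrite ?up ?vq// !dotE !(wedge_frame_dot F); ring.
Qed.

Lemma dihedral_OA P u v p q : wedge_frame P u v -> 0 < p ->
  dihedral 0 (p *: u) P (q *: v) = acos 0.
Proof.
move=> F p0; rewrite /dihedral /angle dot_orth !subr0.
  by rewrite !dotE !(wedge_frame_dot F) !mulr0 !mul0r subrr mul0r.
by rewrite -dot_eq0 !dotE !(wedge_frame_dot F) mulr1 mulf_neq0 ?gt_eqF.
Qed.

(** Here the base is orthogonal to [P], so the difference of [w] and [z] is
    [P] itself and orthogonal to [z]: the dihedral angle is the angle of a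
    right triangle with legs [enorm z <= 1] and 1. *)
Lemma dihedral_AB P u v p q : wedge_frame P u v -> 0 < p -> 0 < q -> p <= 1 ->
  acos (7 / 8) <= dihedral (p *: u) (q *: v) 0 P <= acos 0.
Proof.
move=> F p0 q0 p1; rewrite /dihedral /angle; set d := q *: v - p *: u.
have dd : dot d d = (p - 7 / 8 * q) ^+ 2 + 15 / 64 * q ^+ 2.
  by rewrite !dotE !(wedge_frame_dot F); field.
have d0 : d != 0.
  by rewrite -dot_eq0 dd gt_eqF// ltr_wpDl ?sqr_ge0// mulr_gt0 ?exprn_gt0//; lra.
set z := orth d _; set w := orth d _.
have Pd : dot P d = 0 by rewrite !dotE !(wedge_frame_dot F); ring.
clearbody d.
have zz : dot z z = p ^+ 2 - dot (p *: u) d ^+ 2 / dot d d.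
  rewrite dot_orth// sub0r [dot (- _) d]dotNl dotNl dotNr.
  by rewrite !dotZl !dotZr !(wedge_frame_dot F); field; rewrite dot_eq0.
have zw : dot z w = dot z z.
  rewrite zz dot_orth// sub0r [dot (- _) d]dotNl [dot (P - _) d]dotBl Pd.
  rewrite dotNl dotBr !dotZl !dotZr !(wedge_frame_dot F).
  by field; rewrite dot_eq0.
have ww : dot w w = 1 + dot z z.
  rewrite zz dot_orth// [dot (P - _) d]dotBl Pd.
  rewrite dotBl !dotBr !dotZl !dotZr !(wedge_frame_dot F).
  by field; rewrite dot_eq0.
have z1 : dot z z <= 1.
  by rewrite zz lerBlDr (le_trans (_ : _ <= 1)) ?expr_le1 ?(ltW p0)// lerDl
       divr_ge0 ?sqr_ge0 ?dot_ge0.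
have w0 : 0 < enorm w by rewrite sqrtr_gt0 ww ltr_pwDl ?dot_ge0.
rewrite zw -sqr_enorm expr2.
have -> : enorm z * enorm z / (enorm z * enorm w) = enorm z / enorm w.
  have [->|z0] := eqVneq (enorm z) 0; first by rewrite !mul0r.
  by field; rewrite z0 gt_eqF.
have c0 : 0 <= enorm z / enorm w by rewrite divr_ge0 ?enorm_ge0.
have c1 : enorm z / enorm w <= 7 / 8.
  rewrite ler_pdivrMr// -(@ler_pXn2r _ 2) ?nnegrE ?mulr_ge0 ?enorm_ge0 ?invr_ge0//.
  by rewrite exprMn !sqr_enorm ww; have := dot_ge0 z; lra.
rewrite !ler_acos ?in_itv /= ?c0 ?c1 ?andbT//; apply/andP; split; lra.
Qed.

End Wedge.

(** * The invariant of the branch *)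

Section ThinWedge.
Context {R : realType}.
Implicit Types (P u v A B Q X Y Z W : 'rV[R]_3) (p q : R).

(** The bound [3 / 4 * q <= p] is an equality for the initial wedge; it is
    what keeps the obtuse angles below [acos (- (1 / 4))]. *)
Definition thin p q : Prop :=
  [/\ 0 < p, 3 / 4 * q <= p, p <= 4 / 5 * q & p <= 3 / 16].

Definition cut_at p q := p * q / (p + slant p q).

Lemma thin_gt0 p q : thin p q -> 0 < q.
Proof. by move=> [? ? ? ?]; lra. Qed.

(** Both bounds on the new ratio say that [p + slant p q] lies between
    [5/4 q] and [4/3 q]. *)
Lemma thin_cut p q : thin p q ->
  thin (cut_at p q) p /\ cut_at p q < p.
Proof.
move=> pq; have q0 := thin_gt0 pq; case: pq => p0 qp pq p1.
have s0 : 0 < slant p q by rewrite slant_gt0// gt_eqF.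
have ps0 : 0 < p + slant p q by rewrite addr_gt0.
have s_le : slant p q <= 4 / 3 * q - p.
  rewrite -(@ler_pXn2r _ 2) ?nnegrE ?(ltW s0)//; last by lra.
  rewrite sqr_slant -subr_ge0.
  have -> : (4 / 3 * q - p) ^+ 2 -
    (p ^+ 2 + q ^+ 2 - 7 / 4 * (p * q) + 15 / 64 * (p ^+ 2 * q ^+ 2)) =
    q * (7 / 9 * q - 11 / 12 * p - 15 / 64 * (p * (p * q))) by field.
  apply: mulr_ge0; first exact: ltW.
  have : p * (p * q) <= 3 / 16 * (3 / 16 * q).
    by rewrite !ler_pM ?mulr_ge0 ?(ltW p0) ?(ltW q0)//; lra.
  lra.
have s_ge : 5 / 4 * q - p <= slant p q.
  have [|h] := leP (5 / 4 * q - p) 0; first by move=> /le_trans; apply; exact: ltW.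
  rewrite -(@ler_pXn2r _ 2) ?nnegrE ?(ltW s0) ?(ltW h)// sqr_slant.
  have : 0 <= q * (p - 3 / 4 * q) by rewrite mulr_ge0 ?(ltW q0)// subr_ge0.
  have : 0 <= p ^+ 2 * q ^+ 2 by rewrite -exprMn sqr_ge0.
  lra.
rewrite /cut_at; have e1 : 3 / 4 * p <= p * q / (p + slant p q).
  rewrite ler_pdivlMr// mulrAC [p * q]mulrC ler_wpM2r ?(ltW p0)//; lra.
have e2 : p * q / (p + slant p q) <= 4 / 5 * p.
  rewrite ler_pdivrMr// mulrAC [p * q]mulrC ler_wpM2r ?(ltW p0)//; lra.
by split; [split|]; lra.
Qed.

(** After squaring, the lower bound reduces to
    [0 <= 15 * (p - 3/4 q) * (q - p)]. *)
Lemma cos_PA p q : thin p q -> - (1 / 4) <= (p - 7 / 8 * q) / slant p q < 0.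
Proof.
move=> pq; have q0 := thin_gt0 pq; case: pq => p0 qp pq p1.
have s0 : 0 < slant p q by rewrite slant_gt0// gt_eqF.
rewrite ler_pdivlMr// ltr_pdivrMr// mul0r; apply/andP; split; last by lra.
suff : 4 * (7 / 8 * q - p) <= slant p q by lra.
rewrite -(@ler_pXn2r _ 2) ?nnegrE ?mulr_ge0 ?(ltW s0)//; [|lra..].
rewrite sqr_slant.
have : 0 <= (p - 3 / 4 * q) * (q - p) by rewrite mulr_ge0//; lra.
have : 0 <= p ^+ 2 * q ^+ 2 by rewrite -exprMn sqr_ge0.
lra.
Qed.

Lemma cos_PB p q : thin p q -> 0 <= (q - 7 / 8 * p) / slant p q <= 7 / 8.
Proof.
move=> pq; have q0 := thin_gt0 pq; case: pq => p0 qp pq p1.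
have s0 : 0 < slant p q by rewrite slant_gt0// gt_eqF.
rewrite ler_pdivlMr// ler_pdivrMr// mul0r; apply/andP; split; first by lra.
rewrite -(@ler_pXn2r _ 2) ?nnegrE ?mulr_ge0 ?(ltW s0)//; [|lra..].
rewrite exprMn sqr_slant.
have : 0 <= q * (p - 3 / 4 * q) by rewrite mulr_ge0//; lra.
have : 0 <= p ^+ 2 * q ^+ 2 by rewrite -exprMn sqr_ge0.
have := sqr_ge0 q; lra.
Qed.

Lemma thin_dihedral_PA P u v p q : wedge_frame P u v -> thin p q ->
  acos 0 < dihedral P (p *: u) 0 (q *: v) <= acos (- (1 / 4)).
Proof.
move=> F pq; have q0 := thin_gt0 pq; have [p0 _ _ _] := pq.
have /andP[c1 c2] := cos_PA pq; rewrite (dihedral_PA F p0 q0).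
by rewrite ltr_acos ?ler_acos ?in_itv/= ?c1 ?c2//; apply/andP; split; lra.
Qed.

(** The dihedral angle is [acos (7 / 8)] at the edge from [0] to [P], right at
    the two other edges through [0], and at most right at the two edges
    through [q *: v] that avoid [0]. *)
Lemma thin_dihedral_other P u v p q X Y Z W : wedge_frame P u v -> thin p q ->
  perm_eq [:: 0; P; p *: u; q *: v] [:: X; Y; Z; W] ->
  perm_eq [:: X; Y] [:: P; p *: u] /\
    dihedral X Y Z W = dihedral P (p *: u) 0 (q *: v) \/
  acos (7 / 8) <= dihedral X Y Z W <= acos 0.
Proof.
move=> F pq; have q0 := thin_gt0 pq; have [p0 _ _ p1] := pq.
have F' := wedge_frame_sym F.
have acos_le : acos (7 / 8 : R) <= acos 0.
  by rewrite ler_acos ?in_itv/=; first lra; apply/andP; split; lra.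
move: X Y Z W; apply: perm4_ind.
- move=> X Y Z W [[XY <-]|h]; [left|right]; last by rewrite dihedral_swap_ends.
  by split; [rewrite (perm_catC [:: Y] [:: X])|exact: dihedral_swap_ends].
- by move=> X Y Z W; rewrite dihedral_swap_faces.
- by right; rewrite (dihedral_OP F p0 q0) lexx.
- by right; rewrite (dihedral_OA q F p0) lexx andbT.
- by right; rewrite (dihedral_OA p F' q0) lexx andbT.
- by left.
- right; rewrite (dihedral_PA F' q0 p0) slantC.
  have /andP[c1 c2] := cos_PB pq.
  by rewrite !ler_acos ?in_itv/= ?c1 ?c2//; apply/andP; split; lra.
- by right; apply: dihedral_AB F p0 q0 _; lra.
Qed.

Lemma thin_unique_largest P u v p q : wedge_frame P u v -> thin p q ->
  unique_largest_dihedral [tuple 0; P; p *: u; q *: v] P (p *: u) 0 (q *: v).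
Proof.
move=> F pq; split; first by apply/permP => f /=; ring.
move=> X Y Z W /(thin_dihedral_other F pq)[[-> //]|/andP[_ h] _].
by apply: le_lt_trans h _; have /andP[] := thin_dihedral_PA F pq.
Qed.

Lemma thin_largest P u v p q : wedge_frame P u v -> thin p q ->
  largest_dihedral [tuple 0; P; p *: u; q *: v] P (p *: u) 0 (q *: v).
Proof.
move=> F pq; split; first by apply/permP => f /=; ring.
move=> X Y Z W /(thin_dihedral_other F pq)[[_ -> //]|/andP[_ h]].
by apply: le_trans h _; have /andP[/ltW] := thin_dihedral_PA F pq.
Qed.

Lemma thin_dihedral_bounds P u v p q th : wedge_frame P u v -> thin p q ->
  dihedral_angles [tuple 0; P; p *: u; q *: v] th ->
  acos (7 / 8) <= th <= acos (- (1 / 4)).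
Proof.
move=> F pq [X [Y [Z [W [/(thin_dihedral_other F pq) h ->]]]]].
have /andP[PA1 PA2] := thin_dihedral_PA F pq.
have acos_le : acos (7 / 8 : R) <= acos 0.
  by rewrite ler_acos ?in_itv/=; first lra; apply/andP; split; lra.
case: h => [[_ ->]|/andP[h1 h2]].
  by rewrite PA2 andbT (le_trans acos_le)// ltW.
by rewrite h1 (le_trans h2)// (le_trans (ltW PA1)).
Qed.

Lemma angle_le_acute u v : 0 <= dot u v -> angle u v <= acos (- (1 / 4)).
Proof.
move=> uv; apply: angle_le; first by apply/andP; split; lra.
by apply: le_trans uv; rewrite mulNr oppr_le0 !mulr_ge0 ?enorm_ge0 ?invr_ge0.
Qed.

Lemma thin_face_bounds P u v p q th : wedge_frame P u v -> thin p q ->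
  face_angles [tuple 0; P; p *: u; q *: v] th -> th <= acos (- (1 / 4)).
Proof.
move=> F pq [X [Y [Z [W [XYZW ->]]]]].
have q0 := thin_gt0 pq; have [p0 qp pq' p1] := pq.
suff key : forall X Y Z W,
    perm_eq [:: 0; P; p *: u; q *: v] [:: X; Y; Z; W] ->
    angle_at X Z Y <= acos (- (1 / 4)) /\ angle_at X W Y <= acos (- (1 / 4)).
  have [//|//] := key X Z Y W; apply: perm_trans XYZW _.
  by apply/permP => f /=; ring.
have pp : 0 < p * p by rewrite mulr_gt0.
have pq0 : 0 < p * q by rewrite mulr_gt0.
have qq : 0 < q * q by rewrite mulr_gt0.
have qqp : 7 / 8 * (p * q) <= q * q by rewrite mulrA ler_wpM2r ?(ltW q0)//; lra.
have dotsE := (@dotE R, wedge_frame_dot F).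
(* Only the two face angles at [p *: u] next to [q *: v] can be obtuse, and
   both have the same scalar product in their cosine. *)
have enormB : 4 * (7 / 8 * q - p) <= enorm (q *: v - p *: u).
  rewrite -(@ler_pXn2r _ 2) ?nnegrE ?mulr_ge0 ?enorm_ge0//; last by lra.
  rewrite sqr_enorm !dotsE.
  have : 0 <= (p - 3 / 4 * q) * (q - p) by rewrite mulr_ge0//; lra.
  lra.
have obtuse x : dot x (q *: v - p *: u) = p * (p - 7 / 8 * q) -> p <= enorm x ->
    angle x (q *: v - p *: u) <= acos (- (1 / 4)).
  move=> xE x_ge; apply: angle_le; first by apply/andP; split; lra.
  rewrite xE; have : p * (4 * (7 / 8 * q - p)) <= enorm x * enorm (q *: v - p *: u).
    by rewrite ler_pM ?mulr_ge0 ?(ltW p0)//; lra.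
  lra.
have A1 : angle (0 - p *: u) (q *: v - p *: u) <= acos (- (1 / 4)).
  apply: obtuse; first by rewrite !dotsE; ring.
  by rewrite -(@ler_pXn2r _ 2) ?nnegrE ?enorm_ge0 ?(ltW p0)// sqr_enorm !dotsE; lra.
have A2 : angle (P - p *: u) (q *: v - p *: u) <= acos (- (1 / 4)).
  apply: obtuse; first by rewrite !dotsE; ring.
  by rewrite -(@ler_pXn2r _ 2) ?nnegrE ?enorm_ge0 ?(ltW p0)// sqr_enorm !dotsE; lra.
apply: perm4_ind.
- by move=> X' Y' Z' W'; rewrite /angle_at !(angleC (Y' - _)).
- by move=> X' Y' Z' W' [].
all: rewrite /angle_at; split => //; try (by rewrite angleC);
  apply: angle_le_acute; rewrite !dotsE; lra.
Qed.

Lemma thin_lab_cut P u v p q : wedge_frame P u v -> thin p q ->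
  let e := cut_at p q in
  lab_cut [tuple 0; P; p *: u; q *: v]
          [tuple 0; P; e *: v; p *: u] [tuple P; p *: u; e *: v; q *: v].
Proof.
move=> F pq e; have q0 := thin_gt0 pq; have [p0 qp pq' p1] := pq.
have s0 : 0 < slant p q by rewrite slant_gt0// gt_eqF.
have k0 : 0 < Num.sqrt (1 + p ^+ 2) by rewrite sqrtr_gt0 ltr_pwDl ?sqr_ge0.
have [zE wE zw] := orth_PA F p0 q0.
have EE : (1 - p / (p + slant p q)) *: 0 + (p / (p + slant p q)) *: (q *: v) = e *: v.
  by rewrite scaler0 add0r scalerA mulrAC.
apply: (@lab_cut_along_bisector _ _ _ _ P (p *: u) 0 (q *: v) (p / (p + slant p q))).
- exact: nondegenerate_wedge.
- exact: thin_largest.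
- by rewrite -dot_eq0 !dotE !(wedge_frame_dot F) gt_eqF//; move: (mulr_gt0 p0 p0); lra.
- by rewrite divr_gt0 ?addr_gt0//= ltr_pdivrMr ?addr_gt0// mul1r ltrDl.
- by rewrite zE divr_gt0.
- by rewrite wE divr_gt0.
- rewrite zE wE zw -subr_gt0.
  have -> : p * (p - 7 / 8 * q) / Num.sqrt (1 + p ^+ 2) ^+ 2 -
    - (p / Num.sqrt (1 + p ^+ 2) * (slant p q / Num.sqrt (1 + p ^+ 2))) =
    p * (slant p q - (7 / 8 * q - p)) / Num.sqrt (1 + p ^+ 2) ^+ 2.
    by field; rewrite gt_eqF.
  have /andP[] := cos_PA pq; rewrite ler_pdivlMr// => h _.
  by rewrite divr_gt0 ?exprn_gt0// mulr_gt0// subr_gt0; lra.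
- by rewrite zE wE; field; rewrite !gt_eqF ?addr_gt0.
- by rewrite EE; apply/permP => f /=; ring.
- by rewrite EE; apply/permP => f /=; ring.
Qed.

End ThinWedge.

(** * Size of a wedge *)

Section WedgeSize.
Context {R : realType}.
Implicit Types (P u v A B Q X Y Z W c d m : 'rV[R]_3) (p q r : R).

Definition wedge P u v p q := [:: 0; P; p *: u; q *: v].

(** The plane [dot (top_normal P u v p q) Q = 1] carries the face of the wedge
    opposite to [0]. *)
Definition top_normal P u v p q := P + p^-1 *: dual u v + q^-1 *: dual v u.

Lemma top_normal_dot P u v p q : wedge_frame P u v ->
  (dot (top_normal P u v p q) u = p^-1) * (dot (top_normal P u v p q) v = q^-1) *
  (dot (top_normal P u v p q) P = 1).
Proof.
move=> F; rewrite /top_normal !dotDl !dotZl !(dual_dot F) !(wedge_frame_dot F).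
by do !split; ring.
Qed.

Lemma wedge_coords P u v p q Q : 0 < p -> 0 < q -> conv (wedge P u v p q) Q ->
  exists x y z, [/\ Q = x *: u + y *: v + z *: P, 0 <= x <= p, 0 <= y <= q & 0 <= z <= 1].
Proof.
move=> p0 q0 /conv4P[a [b [c [d [[a0 b0 c0 d0] abcd ->]]]]].
exists (c * p), (d * q), b; split.
- by apply/rowP => i; rewrite !mxE; ring.
- by rewrite mulr_ge0 ?(ltW p0)//= ler_piMl ?(ltW p0)//; lra.
- by rewrite mulr_ge0 ?(ltW q0)//= ler_piMl ?(ltW q0)//; lra.
- by apply/andP; split; lra.
Qed.

Lemma wedge_dist P u v p q Q Q' : wedge_frame P u v -> 0 < p -> p <= q ->
  conv (wedge P u v p q) Q -> conv (wedge P u v p q) Q' ->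
  enorm (Q - Q') <= 1 + 2 * q.
Proof.
move=> F p0 pq; have q0 : 0 < q by lra.
move=> /(wedge_coords p0 q0)[x [y [z [-> /andP[x0 x1] /andP[y0 y1] /andP[z0 z1]]]]].
move=> /(wedge_coords p0 q0)[x' [y' [z' [-> /andP[x0' x1'] /andP[y0' y1'] /andP[z0' z1']]]]].
rewrite -(@ler_pXn2r _ 2) ?nnegrE ?enorm_ge0//; last by lra.
rewrite sqr_enorm.
have -> : dot (x *: u + y *: v + z *: P - (x' *: u + y' *: v + z' *: P))
  (x *: u + y *: v + z *: P - (x' *: u + y' *: v + z' *: P)) =
  (x - x') ^+ 2 + (y - y') ^+ 2 + 7 / 4 * ((x - x') * (y - y')) + (z - z') ^+ 2.
  by rewrite !dotE !(wedge_frame_dot F); field.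
have le_sqr (a b : R) : - b <= a -> a <= b -> a ^+ 2 <= b ^+ 2.
  by move=> h1 h2; rewrite -subr_ge0 subr_sqr mulr_ge0//; lra.
have h1 : (x - x') ^+ 2 <= q ^+ 2 by apply: le_sqr; lra.
have h2 : (y - y') ^+ 2 <= q ^+ 2 by apply: le_sqr; lra.
have h3 : (z - z') ^+ 2 <= 1 ^+ 2 by apply: le_sqr; lra.
have := sqr_ge0 q; have := sqr_ge0 ((x - x') - (y - y')).
move: h1 h2 h3 (q0); move: (x - x') (y - y') (z - z') => a b c h1 h2 h3; lra.
Qed.

Lemma wedge_near_axis P u v p q Q : wedge_frame P u v -> 0 < p -> p <= q ->
  conv (wedge P u v p q) Q ->
  0 <= dot P Q <= 1 /\ enorm (Q - dot P Q *: P) <= 2 * q.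
Proof.
move=> F p0 pq; have q0 : 0 < q by lra.
move=> /(wedge_coords p0 q0)[x [y [z [-> /andP[x0 x1] /andP[y0 y1] /andP[z0 z1]]]]].
have -> : dot P (x *: u + y *: v + z *: P) = z.
  by rewrite !dotE !(wedge_frame_dot F); ring.
split; first by rewrite z0.
rewrite addrK -(@ler_pXn2r _ 2) ?nnegrE ?enorm_ge0//; last by lra.
rewrite sqr_enorm !dotE !(wedge_frame_dot F).
have h1 : x * x <= q * q by rewrite ler_pM//; lra.
have h2 : y * y <= q * q by rewrite ler_pM//.
have h3 : x * y <= q * q by rewrite ler_pM//; lra.
have := mulr_gt0 q0 q0; lra.
Qed.

Lemma wedge_dist_has_ubound P u v p q : wedge_frame P u v -> 0 < p -> p <= q ->
  ubound [set enorm (Q.1 - Q.2) | Q in conv (wedge P u v p q) `*` conv (wedge P u v p q)]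
    (1 + 2 * q).
Proof.
by move=> F p0 pq _ [[Q Q'] [/= TQ TQ']] <-; exact: (wedge_dist F p0 pq TQ TQ').
Qed.

Lemma wedge_diam P u v p q : wedge_frame P u v -> 0 < p -> p <= q ->
  1 <= diam (conv (wedge P u v p q)) <= 1 + 2 * q.
Proof.
move=> F p0 pq; have ub := wedge_dist_has_ubound F p0 pq.
have PO : [set enorm (Q.1 - Q.2) | Q in conv (wedge P u v p q) `*`
    conv (wedge P u v p q)] 1.
  exists (P, 0); first by split; apply: conv_vertex; rewrite !inE eqxx ?orbT.
  by rewrite subr0; apply: enormE; rewrite ?(wedge_frame_dot F) ?expr1n.
apply/andP; split; first by apply: ub_le_sup PO; exists (1 + 2 * q).
by apply: ge_sup ub; exists 1.
Qed.

(** The lowest point of the ball in the direction [d] is at distance [r] from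
    the centre [c]. *)
Lemma ball_in_halfspace (S : set 'rV[R]_3) c d r k : d != 0 -> 0 <= r ->
    [set Q | enorm (Q - c) <= r] `<=` S -> (forall Q, S Q -> k <= dot d Q) ->
  k + r * enorm d <= dot d c.
Proof.
move=> d0 r0 ballS dS; have dn : 0 < enorm d by rewrite enorm_gt0.
have /ballS/dS : enorm (c - (r / enorm d) *: d - c) <= r.
  rewrite addrAC subrr sub0r -scaleNr enormZ normrN ger0_norm ?divr_ge0 ?(ltW dn)//.
  by rewrite divfK ?gt_eqF.
rewrite dotBr dotZr -sqr_enorm.
have -> : r / enorm d * enorm d ^+ 2 = r * enorm d by field; rewrite gt_eqF.
lra.
Qed.

(** In the oblique coordinates of the frame, a centre [c] at distance at least
    [r] from the two faces through [0] and [P] has its coordinates along [u]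
    and [v] at least [r * 8 / sqrt 15]; the face opposite to [0] bounds
    their sum, weighted by [p^-1] and [q^-1], by 1. *)
Lemma ball_in_wedge P u v p q c r : wedge_frame P u v -> 0 < p -> 0 < q -> 0 <= r ->
  [set Q | enorm (Q - c) <= r] `<=` conv (wedge P u v p q) ->
  r * (p^-1 + q^-1) <= Num.sqrt 15 / 8.
Proof.
move=> F p0 q0 r0 ballT; have s15 : 0 < Num.sqrt (15 : R) by rewrite sqrtr_gt0.
have F' := wedge_frame_sym F.
have dual_neq0 u' v' : wedge_frame P u' v' -> dual u' v' != 0.
  by move=> G; rewrite -enorm_gt0 (enorm_dual G) divr_gt0.
have hx : 0 + r * enorm (dual u v) <= dot (dual u v) c.
  apply: ball_in_halfspace ballT _ => //; first by apply: dual_neq0.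
  move=> Q; apply: conv_ge => X.
  rewrite !inE => /or4P[] /eqP ->; rewrite ?dot0r ?dotZr ?(dual_dot F) ?mulr0 ?mulr1//.
  exact: ltW.
have hy : 0 + r * enorm (dual v u) <= dot (dual v u) c.
  apply: ball_in_halfspace ballT _ => //; first by apply: dual_neq0.
  move=> Q; apply: conv_ge => X.
  rewrite !inE => /or4P[] /eqP ->; rewrite ?dot0r ?dotZr ?(dual_dot F) ?mulr0 ?mulr1//.
  exact: ltW.
have Tc : conv (wedge P u v p q) c by apply: ballT; rewrite /= subrr /enorm dot0l sqrtr0.
have hz : 0 <= dot P c.
  apply: conv_ge Tc => X.
  by rewrite !inE => /or4P[] /eqP ->; rewrite ?dot0r ?dotZr ?(wedge_frame_dot F) ?mulr0.
have : dot (top_normal P u v p q) c <= 1.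
  apply: conv_le Tc => X; rewrite !inE => /or4P[] /eqP ->;
  by rewrite ?dot0r ?dotZr ?(top_normal_dot _ _ F) ?mulfV ?gt_eqF.
rewrite /top_normal !dotDl !dotZl.
move: hx hy; rewrite (enorm_dual F) (enorm_dual F') !add0r => hx hy.
have := ler_wpM2l (ltW (eqbRL (invr_gt0 p) p0)) hx.
have := ler_wpM2l (ltW (eqbRL (invr_gt0 q) q0)) hy.
move=> {hx hy} hx hy h; rewrite ler_pdivlMr//.
have -> : r * (p^-1 + q^-1) * 8 =
  Num.sqrt 15 * (p^-1 * (r * (8 / Num.sqrt 15)) + q^-1 * (r * (8 / Num.sqrt 15))).
  by field; rewrite !gt_eqF.
by rewrite -[leRHS]mulr1 ler_pM2l//; lra.
Qed.

(** The centre is the centroid.  Since [dual u v] and [dual v u] have norm at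
    most 3, moving by [p / 100] changes each barycentric coordinate by less
    than [1/4]. *)
Lemma wedge_inball P u v p q : wedge_frame P u v -> 0 < p -> p <= q -> p <= 1 ->
  exists2 r, 0 < r & exists c, [set Q | enorm (Q - c) <= r] `<=` conv (wedge P u v p q).
Proof.
move=> F p0 pq p1; have q0 : 0 < q by lra.
exists (p / 100); first by rewrite divr_gt0.
pose c : 'rV[R]_3 := (p / 4) *: u + (q / 4) *: v + 4^-1 *: P.
exists c => Q /= Qc; have [_ [_ _ span]] := F.
have F' := wedge_frame_sym F.
have [x [y [z QE]]] := span Q.
have dual_le u' v' : wedge_frame P u' v' -> enorm (dual u' v') <= 3.
  move=> G; rewrite -(@ler_pXn2r _ 2) ?nnegrE ?enorm_ge0//.
  by rewrite sqr_enorm /dual !dotE !(wedge_frame_dot G); lra.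
have dev m k : enorm m <= k -> `|dot m Q - dot m c| <= k * (p / 100).
  move=> mk; rewrite -dotBr; apply: le_trans (normr_dot_le _ _) _.
  by apply: ler_pM; rewrite ?enorm_ge0.
have dev1 := dev _ _ (dual_le _ _ F); have dev2 := dev _ _ (dual_le _ _ F').
have P1 : enorm P <= 1 by rewrite /enorm (wedge_frame_dot F) sqrtr1.
have {dev} dev3 := dev _ _ P1.
move: dev1 dev2 dev3; rewrite QE /c !dotDr !dotZr !(dual_dot F) !(wedge_frame_dot F).
rewrite !ler_norml => /andP[x1 x2] /andP[y1 y2] /andP[z1 z2].
apply/conv4P; exists (1 - z - x / p - y / q), z, (x / p), (y / q); split.
- have h1 : x / p <= 1 / 4 + 3 / 100 by rewrite ler_pdivrMr//; lra.
  have h2 : y / q <= 1 / 4 + 3 / 100 by rewrite ler_pdivrMr//; lra.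
  by split; rewrite ?divr_ge0 ?(ltW p0) ?(ltW q0)//; lra.
- by ring.
- by apply/rowP => i; rewrite !mxE; field; rewrite !gt_eqF.
Qed.

Lemma wedge_inradius P u v p q : wedge_frame P u v -> 0 < p -> p <= q -> p <= 1 ->
  0 < inradius (conv (wedge P u v p q)) <= Num.sqrt 15 / 8 / (p^-1 + q^-1).
Proof.
move=> F p0 pq p1; have q0 : 0 < q by lra.
have pq0 : 0 < p^-1 + q^-1 by rewrite addr_gt0 ?invr_gt0.
set S := [set r | 0 <= r /\ exists c, [set Q | enorm (Q - c) <= r] `<=` conv (wedge P u v p q)].
have ub : ubound S (Num.sqrt 15 / 8 / (p^-1 + q^-1)).
  move=> r [r0 [c ballT]]; rewrite ler_pdivlMr//.
  exact: ball_in_wedge ballT.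
have [r r0 [c ballT]] := wedge_inball F p0 pq p1.
have Sr : S r by split; [exact: ltW|exists c].
apply/andP; split; last by apply: ge_sup ub; exists r.
by apply: lt_le_trans r0 _; apply: ub_le_sup Sr; eexists; exact: ub.
Qed.

End WedgeSize.

(** * The branch and its partitions *)

Section Zigzag.
Context {R : realType}.
Implicit Types (Q X : 'rV[R]_3).

Definition apex : 'rV[R]_3 := vec3 0 0 1.

(** The nodes alternate between the two rays; node 0 is [B0], which lies on the
    oblique one. *)
Definition ray n : 'rV[R]_3 :=
  if odd n then vec3 1 0 0 else vec3 (7 / 8) (Num.sqrt 15 / 8) 0.

Lemma eq_vec3 Q (a b c : R) :
  Q 0 0 = a -> Q 0 1 = b -> Q 0 2%:R = c -> Q = vec3 a b c.
Proof.
move=> <- <- <-; apply/rowP => i; rewrite mxE.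
by case: i => [[|[|[|//]]] lti] /=; congr (Q 0 _); apply: val_inj.
Qed.

Lemma dot_vec3 (a b c a' b' c' : R) :
  dot (vec3 a b c) (vec3 a' b' c') = a * a' + b * b' + c * c'.
Proof. by rewrite /dot !big_ord_recl big_ord0 !mxE /= addr0 addrA. Qed.

Lemma rays_frame : wedge_frame apex (ray 1) (ray 0).
Proof.
have s0 : Num.sqrt (15 : R) != 0 by rewrite gt_eqF ?sqrtr_gt0.
have s2 : Num.sqrt (15 : R) * Num.sqrt 15 = 15 by rewrite -expr2 sqr_sqrtr.
rewrite /ray /apex /=; split; split; rewrite ?dot_vec3; [lra|lra|lra|lra|lra|lra|].
move=> Q; exists (Q 0 0 - 7 * Q 0 1 / Num.sqrt 15), (8 * Q 0 1 / Num.sqrt 15), (Q 0 2%:R).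
have -> : Q = vec3 (Q 0 0) (Q 0 1) (Q 0 2%:R) by exact: eq_vec3.
by apply/esym/eq_vec3; rewrite !mxE /=; field.
Qed.

Lemma raySS n : ray n.+2 = ray n.
Proof. by rewrite /ray /= negbK. Qed.

Lemma ray_frame n : wedge_frame apex (ray n.+1) (ray n).
Proof.
elim: n => [|n ih]; first exact: rays_frame.
by rewrite raySS; exact: wedge_frame_sym.
Qed.

(** The pair of the distances from [0] to [A n] and to [B n]. *)
Definition legs n : R * R :=
  iter n (fun pq => (cut_at pq.1 pq.2, pq.1)) (3 / 16, 4^-1).

(** Since the longer leg of a wedge is the shorter leg of the preceding one,
    all the legs form one sequence: [A n] and [B n] are at distances
    [leg n.+1] and [leg n] from [0]. *)
Definition leg n := (legs n).2.

Lemma legSS n : leg n.+2 = cut_at (leg n.+1) (leg n).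
Proof. by []. Qed.

Lemma leg_thin n : thin (leg n.+1) (leg n).
Proof.
elim: n => [|n ih]; first by split; rewrite /leg /=; lra.
by rewrite legSS; have [] := thin_cut ih.
Qed.

Lemma leg_gt0 n : 0 < leg n.
Proof. exact: thin_gt0 (leg_thin n). Qed.

Lemma leg_decr n : leg n.+1 < leg n.
Proof. by have [_ _ h _] := leg_thin n; have := leg_gt0 n; lra. Qed.

Lemma leg_lt m n : (m < n)%N -> leg n < leg m.
Proof.
elim: n => // n ih; rewrite ltnS leq_eqVlt => /predU1P[->|/ih]; first exact: leg_decr.
exact/lt_trans/leg_decr.
Qed.

Lemma short_leg_le_geometric n : leg n.+1 <= 3 / 16 * (4 / 5) ^+ n.
Proof.
elim: n => [|n ih]; first by rewrite expr0 mulr1.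
have [_ _ h _] := leg_thin n.+1; rewrite exprSr; lra.
Qed.

Lemma long_leg_le_geometric n : leg n <= 1 / 4 * (4 / 5) ^+ n.
Proof.
have := short_leg_le_geometric n; have [_ h _ _] := leg_thin n; lra.
Qed.

Definition node n : 'rV[R]_3 := leg n *: ray n.

Definition wedge_tetra n : tetra R := [tuple 0; apex; node n.+1; node n].

Definition cut_off n : tetra R := [tuple apex; node n.+1; node n.+2; node n].

Lemma wedge_lab_cut n :
  lab_cut (wedge_tetra n) (wedge_tetra n.+1) (cut_off n).
Proof.
have := thin_lab_cut (ray_frame n) (leg_thin n).
by rewrite -legSS /cut_off /wedge_tetra /node !raySS.
Qed.

Lemma conv_wedge_split n :
  conv (wedge_tetra n) = conv (wedge_tetra n.+1) `|` conv (cut_off n).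
Proof.
have E : open_segment 0 (node n) (node n.+2).
  exists (leg n.+2 / leg n); split.
    rewrite divr_gt0 ?leg_gt0//= ltr_pdivrMr ?leg_gt0// mul1r.
    by apply: lt_trans (leg_decr _) (leg_decr _).
  rewrite scaler0 add0r /node scalerA divfK ?gt_eqF ?leg_gt0//.
  by rewrite raySS.
have -> : conv (wedge_tetra n) = conv [:: apex; node n.+1; 0; node n].
  by apply: perm_conv; apply/permP => f /=; ring.
rewrite (conv_split _ _ E); congr (_ `|` _).
by apply: perm_conv; apply/permP => f /=; ring.
Qed.

(** The normal of the face that the cut of [wedge_tetra n] creates: this face
    is opposite to [0] in [wedge_tetra n.+1]. *)
Definition separator n := top_normal apex (ray n.+2) (ray n.+1) (leg n.+2) (leg n.+1).

Lemma separator_apex n : dot (separator n) apex = 1.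
Proof. by rewrite /separator (top_normal_dot _ _ (ray_frame n.+1)). Qed.

Lemma eq_ray m n : odd m = odd n -> ray m = ray n.
Proof. by rewrite /ray => ->. Qed.

Lemma separator_node n k : dot (separator n) (node k) =
  leg k / leg (if odd k == odd n then n.+2 else n.+1).
Proof.
have D := top_normal_dot (leg n.+2) (leg n.+1) (ray_frame n.+1).
rewrite /separator /node dotZr; case: eqP => kn.
  have /eq_ray -> : odd k = odd n.+2 by rewrite kn /= negbK.
  by rewrite D.
have /eq_ray -> : odd k = odd n.+1 by case: (odd k) kn => /=; case: (odd n).
by rewrite D.
Qed.

Lemma separator_node_eq1 n k : k \in [:: n.+1; n.+2] -> dot (separator n) (node k) = 1.
Proof.
rewrite !inE separator_node => /orP[] /eqP ->; rewrite /= ?negbK.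
  by case: (odd n) => /=; rewrite mulfV ?gt_eqF ?leg_gt0.
by rewrite eqxx mulfV ?gt_eqF ?leg_gt0.
Qed.

Lemma separator_node_lt1 n k : (n.+2 < k)%N -> dot (separator n) (node k) < 1.
Proof.
move=> nk; rewrite separator_node ltr_pdivrMr ?leg_gt0// mul1r.
by apply: leg_lt; case: ifP => _ //; exact: ltn_trans nk.
Qed.

Lemma separator_node_gt1 n : 1 < dot (separator n) (node n).
Proof.
rewrite separator_node eqxx ltr_pdivlMr ?leg_gt0// mul1r.
exact: leg_lt.
Qed.

Lemma separator_neq0 n : separator n != 0.
Proof.
apply/eqP => s0; have := separator_apex n.
by rewrite s0 dot0l => /esym/eqP; rewrite oner_eq0.
Qed.

(** The plane of the new face separates [cut_off n] from every later piece [T]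
    of the partition: [node n] lies beyond it, [apex], [node n.+1] and
    [node n.+2] on it, and [0] and the later nodes on the side of [0]. *)
Lemma cut_off_meets (T : tetra R) n :
    {in T, forall X, [\/ X = 0, X = apex | exists2 k, (n < k)%N & X = node k]} ->
    (exists2 X, X \in T & dot (separator n) X < 1) ->
  meet_in_common_face T (cut_off n) /\ (conv T)° `&` (conv (cut_off n))° = set0.
Proof.
move=> TV [Y YT Y1]; pose m := separator n.
have T_eq X : X \in T -> X \in cut_off n \/ dot m X < 1.
  move=> /TV[->|->|[k nk ->]].
  - by right; rewrite dot0r.
  - by left; rewrite !inE eqxx.
  - have [nk2|] := ltnP n.+2 k; first by right; exact: separator_node_lt1.
    rewrite leq_eqVlt => /predU1P[->|]; first by left; rewrite !inE eqxx ?orbT.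
    rewrite ltnS leq_eqVlt => /predU1P[->|]; first by left; rewrite !inE eqxx ?orbT.
    by rewrite ltnS leqNgt nk.
have mS : {in cut_off n, forall X, 1 <= dot m X}.
  move=> X; rewrite !inE => /or4P[] /eqP ->.
  - by rewrite separator_apex.
  - by rewrite separator_node_eq1 ?inE ?eqxx.
  - by rewrite separator_node_eq1 ?inE ?eqxx ?orbT.
  - by rewrite ltW// separator_node_gt1.
have mT : {in T, forall X, dot m X <= 1}.
  move=> X /TV[->|->|[k nk ->]].
  - by rewrite dot0r.
  - by rewrite separator_apex.
  - have [nk2|kn2] := ltnP n.+2 k; first by rewrite ltW// separator_node_lt1.
    rewrite separator_node_eq1// !inE.
    by move: kn2; rewrite leq_eqVlt ltnS (leq_eqVlt k) [(k < _)%N]ltnNge nk orbF orbC.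
split; last first.
  apply: (@separated_interior _ m 1); first exact: separator_neq0.
    by move=> Q; exact: conv_le.
  by move=> Q; exact: conv_ge.
have TS : {in T, forall X, dot m X = 1 -> X \in cut_off n}.
  by move=> X /T_eq[//|+ X1]; rewrite X1 ltxx.
exists (undup [seq X <- T | dot m X == 1]); split.
- exact: undup_uniq.
- apply: leq_trans (size_undup _) _; rewrite size_filter.
  suff : (count (fun X => dot m X == 1%R) T < size T)%N by rewrite size_tuple ltnS.
  rewrite -(count_predC (fun X => dot m X == 1) T) -addn1 leq_add2l -has_count.
  by apply/hasP; exists Y; rewrite //= lt_eqF.
- by move=> X; rewrite mem_undup mem_filter => /andP[].
- by move=> X; rewrite mem_undup mem_filter => /andP[/eqP mX] /TS; exact.
- rewrite (separated_meet mT mS TS).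
  by apply/seteqP; split; apply: sub_conv => X; rewrite mem_undup.
Qed.

Fixpoint cut_offs n : seq (tetra R) :=
  if n is m.+1 then cut_off m :: cut_offs m else [::].

Lemma size_cut_offs n : size (cut_offs n) = n.
Proof. by elim: n => //= n ->. Qed.

Lemma nth_cut_offs T n i : (i < n)%N -> nth T (cut_offs n) i = cut_off (n - i.+1).
Proof.
elim: n i => // n ih [|i] /=; first by rewrite subn1.
by rewrite ltnS => /ih ->.
Qed.

Definition triangulation n := wedge_tetra n :: cut_offs n.

Lemma wedge_nondegenerate n : nondegenerate (wedge_tetra n).
Proof. exact: nondegenerate_wedge (ray_frame n) (leg_gt0 _) (leg_gt0 _). Qed.

Lemma cut_off_nondegenerate n : nondegenerate (cut_off n).
Proof.
rewrite /cut_off /node raySS.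
apply: nondegenerate_cut (ray_frame n) (leg_gt0 _) _.
exact: lt_trans (leg_decr _) (leg_decr _).
Qed.

Lemma triangulation_cover n Q :
  conv (wedge_tetra 0) Q <-> exists2 T, T \in triangulation n & conv T Q.
Proof.
elim: n => [|n ->].
  split=> [TQ|[T]]; first by exists (wedge_tetra 0); rewrite ?mem_head.
  by rewrite inE => /eqP ->.
split=> -[T]; rewrite !inE.
  move=> /predU1P[->|TD TQ]; last by exists T; rewrite // !inE TD !orbT.
  rewrite conv_wedge_split => -[] TQ; first by exists (wedge_tetra n.+1); rewrite // mem_head.
  by exists (cut_off n); rewrite // !inE eqxx orbT.
move=> /or3P[/eqP ->|/eqP ->|TD] TQ; last by exists T; rewrite // inE TD orbT.
  by exists (wedge_tetra n); rewrite ?mem_head// conv_wedge_split; left.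
by exists (wedge_tetra n); rewrite ?mem_head// conv_wedge_split; right.
Qed.

(** The pieces are listed from the latest to the earliest, so the first one of
    a pair is a later piece with respect to the second. *)
Lemma triangulation_meets n i j : (i < j < size (triangulation n))%N ->
  let Ti := nth (wedge_tetra 0) (triangulation n) i in
  let Tj := nth (wedge_tetra 0) (triangulation n) j in
  meet_in_common_face Ti Tj /\ (conv Ti)° `&` (conv Tj)° = set0.
Proof.
case: j => [|j]; first by rewrite ltn0.
rewrite /= size_cut_offs !ltnS => /andP[ij jn]; rewrite nth_cut_offs//.
case: i ij => [|i] ij /=.
  apply: cut_off_meets; last by exists 0; rewrite ?mem_head ?dot0r.
  have nj : (n - j.+1 < n)%N by rewrite ltn_subrL (leq_ltn_trans _ jn).
  move=> X; rewrite !inE => /or4P[] /eqP ->; [exact: Or31|exact: Or32| |]; apply: Or33.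
    by exists n.+1; rewrite // ltnS ltnW.
  by exists n.
rewrite nth_cut_offs ?(ltn_trans ij)//.
have nij : (n - j.+1 < n - i.+1)%N by rewrite ltn_sub2l// (leq_ltn_trans _ jn).
apply: cut_off_meets.
  move=> X; rewrite !inE => /or4P[] /eqP ->; [exact: Or32| | |]; apply: Or33.
  - by exists (n - i.+1).+1; rewrite // ltnS ltnW.
  - by exists (n - i.+1).+2; rewrite // ltnS ltnW// ltnS ltnW.
  - by exists (n - i.+1)%N.
exists (node (n - i.+1).+2); first by rewrite !inE eqxx ?orbT.
by apply: separator_node_lt1; rewrite !ltnS.
Qed.

Lemma triangulation_conforming n :
  conforming_partition (wedge_tetra 0) (triangulation n).
Proof.
split; last by move=> i j /triangulation_meets[].
split; last by move=> i j /triangulation_meets[].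
  move=> T; rewrite inE => /predU1P[->|]; first exact: wedge_nondegenerate.
  elim: n => // n ih; rewrite inE => /predU1P[->|//].
  exact: cut_off_nondegenerate.
apply/seteqP; split=> Q; first by move=> /(triangulation_cover n)[T TD TQ]; exists T.
by move=> [T TD TQ]; apply/(triangulation_cover n); exists T.
Qed.

Lemma triangulation_obtained n :
  obtained_by_lab_cuts (wedge_tetra 0) n (triangulation n).
Proof.
elim: n => [|n ih]; first exact: no_lab_cut.
exact: (@one_more_lab_cut _ _ _ [::] _ _ _ _ ih (wedge_lab_cut n)).
Qed.

Lemma wedge_branch : nested_lab_branch (wedge_tetra 0) wedge_tetra.
Proof.
by split=> // n; exists (wedge_tetra n.+1), (cut_off n); split; [exact: wedge_lab_cut|left].
Qed.

Lemma leg_apex_angle n : angle_at 0 apex (node n.+1) <= 1 / 5 * (4 / 5) ^+ n.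
Proof.
have F := ray_frame n; have p0 := leg_gt0 n.+1.
have nv : enorm (0 - apex) = 1.
  by apply: enormE; rewrite // !dotE (wedge_frame_dot F); ring.
have nw : enorm (node n.+1 - apex) = Num.sqrt (1 + leg n.+1 ^+ 2).
  by rewrite /enorm /node !dotE !(wedge_frame_dot F); congr Num.sqrt; ring.
rewrite /angle_at (@angle_atan _ _ _ (leg n.+1)) ?(ltW p0) ?nv ?nw ?sqrtr_gt0//.
- apply: le_trans (atan_le (ltW p0)) _.
  have g0 : 0 < (4 / 5 : R) ^+ n by rewrite exprn_gt0// divr_gt0.
  by have := short_leg_le_geometric n; lra.
- by rewrite ltr_pwDl ?sqr_ge0.
- by rewrite /node !dotE !(wedge_frame_dot F); ring.
Qed.

Lemma leg_le n : leg n.+1 <= leg n. Proof. exact/ltW/leg_decr. Qed.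

Lemma leg_le1 n : leg n.+1 <= 1.
Proof. by have [_ _ _] := leg_thin n; lra. Qed.

Lemma wedge_diam_bounds n : 1 <= diam (conv (wedge_tetra n)) <= 1 + 2 * leg n.
Proof. exact: wedge_diam (ray_frame n) (leg_gt0 _) (leg_le n). Qed.

(** The inverses of the legs are at least [16/3] and [4] times [(5/4) ^ n];
    their sum exceeds the needed [8 (5/4) ^ n]. *)
Lemma wedge_aspect n :
  64 / Num.sqrt 15 * (5 / 4) ^+ n <=
  diam (conv (wedge_tetra n)) / inradius (conv (wedge_tetra n)).
Proof.
have /andP[r0 r1] := wedge_inradius (ray_frame n) (leg_gt0 _) (leg_le n) (leg_le1 n).
have /andP[d1 _] := wedge_diam_bounds n.
rewrite ler_pdivlMr//; apply: le_trans d1; set g := (5 / 4 : R) ^+ n.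
have s0 : 0 < Num.sqrt (15 : R) by rewrite sqrtr_gt0.
have g0 : 0 < g by rewrite exprn_gt0// divr_gt0.
have g45 : (4 / 5 : R) ^+ n = g^-1 by rewrite /g -exprVn invf_div.
have p_ge : 16 / 3 * g <= (leg n.+1)^-1.
  rewrite -[leLHS]invrK lef_pV2 ?posrE ?leg_gt0 ?invr_gt0 ?mulr_gt0 ?invr_gt0//.
  by rewrite invfM invf_div -g45 short_leg_le_geometric.
have q_ge : 4 * g <= (leg n)^-1.
  rewrite -[leLHS]invrK lef_pV2 ?posrE ?leg_gt0 ?invr_gt0 ?mulr_gt0//.
  by rewrite invfM -g45; have := long_leg_le_geometric n; lra.
have h : 8 * g <= (leg n.+1)^-1 + (leg n)^-1 by lra.
have h0 : 0 < (leg n.+1)^-1 + (leg n)^-1 by rewrite addr_gt0 ?invr_gt0 ?leg_gt0.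
have : 64 / Num.sqrt 15 * g * inradius (conv (wedge_tetra n)) <=
  64 / Num.sqrt 15 * g * (Num.sqrt 15 / 8 / ((leg n.+1)^-1 + (leg n)^-1)).
  by rewrite ler_pM2l// !mulr_gt0 ?invr_gt0.
move=> /le_trans; apply.
move: (_ + _) h h0 => k h k0.
have -> : 64 / Num.sqrt 15 * g * (Num.sqrt 15 / 8 / k) = 8 * g / k.
  by field; rewrite !gt_eqF.
by rewrite ler_pdivrMr// mul1r.
Qed.

Lemma geometric_cvg (c : R) : (c * (4 / 5) ^+ n) @[n --> \oo] --> (0 : R).
Proof. by apply: cvg_geometric; rewrite ger0_norm; lra. Qed.

Lemma wedge_diam_cvg : diam (conv (wedge_tetra n)) @[n --> \oo] --> (1 : R).
Proof.
apply: (@squeeze_cvgr _ _ _ _ (fun=> 1) (fun n => 1 + 1 / 2 * (4 / 5) ^+ n)).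
- apply: nearW => n; have /andP[-> h] := wedge_diam_bounds n.
  by apply: le_trans h _; have := long_leg_le_geometric n; lra.
- exact: cvg_cst.
- by rewrite -[X in _ --> X]addr0; apply: cvgD; [exact: cvg_cst|exact: geometric_cvg].
Qed.

(** A common point is within [2 * leg n] of its projection on the line through
    [0] and [apex], for every [n]. *)
Lemma wedge_bigcap : \bigcap_n conv (wedge_tetra n) = conv [:: 0; apex].
Proof.
apply/seteqP; split=> [Q TQ|Q OPQ n _]; last first.
  by apply: sub_conv OPQ => X; rewrite !inE => /orP[] ->; rewrite ?orbT.
have TQn n := wedge_near_axis (ray_frame n) (leg_gt0 _) (leg_le n) (TQ n I).
have [/andP[z0 z1] _] := TQn 0%N.
apply/conv2P; exists (1 - dot apex Q), (dot apex Q); split=> //.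
- by rewrite subr_ge0.
- by rewrite subrK.
rewrite scaler0 add0r; apply/eqP; rewrite -subr_eq0 -[_ == _]negbK -enorm_gt0 -leNgt.
apply: cvgr_to_ge (geometric_cvg (1 / 2)) _; apply: nearW => n.
have [_ /le_trans] := TQn n; apply; have := long_leg_le_geometric n; lra.
Qed.

End Zigzag.

Theorem theorem1p2 (R : realType) :
  let O : 'rV[R]_3 := vec3 0 0 0 in
  let P : 'rV[R]_3 := vec3 0 0 1 in
  let A0 : 'rV[R]_3 := vec3 (3 / 16) 0 0 in
  let B0 : 'rV[R]_3 := vec3 (7 / 32) (Num.sqrt 15 / 32) 0 in
  let T0 : tetra R := [tuple O; P; A0; B0] in
  let gamma : R := acos (7 / 8) in
  let G : R := acos (- (1 / 4)) in
  exists A B : nat -> 'rV[R]_3,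
  let T : nat -> tetra R := fun n => [tuple O; P; A n; B n] in
  [/\ A 0%N = A0, B 0%N = B0, nested_lab_branch T0 T &
      forall n, unique_largest_dihedral (T n) P (A n) O (B n)] /\
  [/\ forall n, angle_at O P (A n) <= 1 / 5 * (4 / 5) ^+ n,
      forall n, diam (conv (T n)) / inradius (conv (T n))
                  >= 64 / Num.sqrt 15 * (5 / 4) ^+ n,
      diam (conv (T n)) @[n --> \oo] --> (1 : R) &
      \bigcap_n conv (T n) = conv [:: O; P]] /\
  [/\ forall n th, dihedral_angles (T n) th -> gamma <= th <= G,
      forall n th, face_angles (T n) th -> th <= G,
      forall n, Gamma (T n) <= G &
      G < pi] /\
  forall n, exists D : seq (tetra R),
    [/\ conforming_partition T0 D, obtained_by_lab_cuts T0 n D,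
        size D = n.+1 & T n \in D].
Proof.
move=> O P A0 B0 T0 gamma G.
have OE : O = 0 by apply/esym/eq_vec3; rewrite mxE.
have A0E : node 1 = A0 by apply: eq_vec3; rewrite !mxE /leg /=; lra.
have B0E : node 0 = B0 by apply: eq_vec3; rewrite !mxE /leg /=; lra.
have T0E : T0 = wedge_tetra 0 by apply: val_inj; rewrite /= -A0E -B0E OE.
exists (fun n => node n.+1), node => T.
have TE : T = wedge_tetra by apply: funext => n; apply: val_inj; rewrite /= OE.
have face n th : face_angles (T n) th -> th <= G.
  by rewrite TE; exact: thin_face_bounds (ray_frame n) (leg_thin n).
have dihedral n th : dihedral_angles (T n) th -> gamma <= th <= G.
  by rewrite TE; exact: thin_dihedral_bounds (ray_frame n) (leg_thin n).
split; last split; last split.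
- split=> //; first by rewrite T0E TE; exact: wedge_branch.
  by move=> n; rewrite TE OE; exact: thin_unique_largest (ray_frame n) (leg_thin n).
- rewrite TE OE; split.
  + exact: leg_apex_angle.
  + exact: wedge_aspect.
  + exact: wedge_diam_cvg.
  + exact: wedge_bigcap.
- split=> //.
  + move=> n; apply: ge_sup.
      exists (angle_at O P (node n.+1)); left.
      by exists O, P, (node n.+1), (node n).
    by move=> th [/face//|/dihedral/andP[]].
  + by rewrite -acosN1 ltr_acos ?in_itv /= ?lexx//; [lra|apply/andP; split; lra|lra].
- move=> n; exists (triangulation n); rewrite T0E TE; split.
  + exact: triangulation_conforming.
  + exact: triangulation_obtained.
  + by rewrite /= size_cut_offs.
  + exact: mem_head.
Qed.
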